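(* Let $\Gamma$ be a reduct of $\mathbb{P}$ such that $\bot$ and $<$ are primitive positive definable in $\Gamma$. Then ${\rm Low}$ is not primitive positive definable in $\Gamma$ if and only if ${\rm Pol}(\Gamma)$ contains one of the functions $e_<$ or $e_\leq$.
   Context: $\mathbb{P}=(P;\leq)$ is the random partial order (Fraïssé limit of all finite partial orders); a reduct of $\mathbb{P}$ is a structure on $P$ whose relations are first-order definable in $\mathbb{P}$. $x<y$ means $x\leq y\wedge x\neq y$; $x\bot y$ means $x,y$ incomparable; $z\bot xy$ abbreviates $z\bot x\wedge z\bot y$. ${\rm Low}(x,y,z):=(x<y\wedge z\bot xy)\vee(x<z\wedge y\bot xz)$. Primitive positive definable: definable by $\exists\bar y$ (conjunction of atomic formulas). ${\rm Pol}(\Gamma)$ is the set of finitary operations on $P$ preserving all relations of $\Gamma$ componentwise. $e_<:P^2\to P$ is a fixed embedding of $(P;<)^2$ into $(P;<)$, i.e. injective with $e_<(a,b)<e_<(a',b')\iff(a<a'\wedge b<b')$; $e_\leq:P^2\to P$ is a fixed embedding of $(P;\leq)^2$ into $(P;\leq)$, i.e. injective with $e_\leq(a,b)\leq e_\leq(a',b')\iff(a\leq a'\wedge b\leq b')$. *)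

(* Defs.v *)
From Stdlib Require Import List.
From mathcomp Require Import all_boot.
Set Implicit Arguments. Unset Strict Implicit. Unset Printing Implicit Defensive.

Section RandomPO.
Variable P : Type.
Variable le : P -> P -> Prop.

Definition ltP (x y : P) : Prop := le x y /\ x <> y.
Definition incompP (x y : P) : Prop := ~ le x y /\ ~ le y x.

(** The random partial order: the Fraisse limit of all finite partial orders,
    characterised (up to isomorphism) as the countable partial order with the
    one-point extension property: every consistent one-point extension of a
    finite subset is realised. *)
Definition extension_property : Prop :=
  forall (A : list P) (Bel Abv : P -> Prop),
    (forall a, List.In a A -> ~ (Bel a /\ Abv a)) ->
    (forall a a', List.In a A -> List.In a' A -> le a a' -> Bel a' -> Bel a) ->
    (forall a a', List.In a A -> List.In a' A -> le a a' -> Abv a -> Abv a') ->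
    (forall a a', List.In a A -> List.In a' A -> Bel a -> Abv a' -> le a a') ->
    exists x, ~ List.In x A /\
      forall a, List.In a A -> ((le a x <-> Bel a) /\ (le x a <-> Abv a)).

Definition random_po : Prop :=
  [/\ (forall x, le x x),
      (forall x y, le x y -> le y x -> x = y),
      (forall x y z, le x y -> le y z -> le x z),
      (exists f : P -> nat, forall x y, f x = f y -> x = y)
    & extension_property].

Inductive fo : Type :=
| FLe : nat -> nat -> fo
| FEq : nat -> nat -> fo
| FNot : fo -> fo
| FAnd : fo -> fo -> fo
| FEx : nat -> fo -> fo.

Fixpoint sat (e : nat -> P) (phi : fo) : Prop :=
  match phi with
  | FLe i j => le (e i) (e j)
  | FEq i j => e i = e j
  | FNot p => ~ sat e p
  | FAnd p q => sat e p /\ sat e q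
  | FEx i p => exists x : P, sat (fun k => if k == i then x else e k) p
  end.

(** An n-ary relation R on P is first-order definable in (P; <=) if some
    formula phi, whose variables 0..n-1 stand for the arguments, defines it
    (its truth being independent of the values of all other variables). *)
Definition fo_definable (n : nat) (R : ('I_n -> P) -> Prop) : Prop :=
  exists phi : fo, forall (t : 'I_n -> P) (e : nat -> P),
    (forall i : 'I_n, e i = t i) -> (R t <-> sat e phi).

End RandomPO.

Record structure (P : Type) : Type := Structure {
  idx : Type;
  ar : idx -> nat;
  rel : forall s : idx, ('I_(ar s) -> P) -> Prop }.

Section Reducts.
Variable P : Type.

Definition reduct (le : P -> P -> Prop) (G : structure P) : Prop :=
  forall s : idx G, fo_definable le (@rel P G s).

Inductive atom (G : structure P) : Type :=
| AEq : nat -> nat -> atom G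
| ARel : forall s : idx G, ('I_(ar s) -> nat) -> atom G.

Definition atom_sat (G : structure P) (e : nat -> P) (a : atom G) : Prop :=
  match a with
  | AEq i j => e i = e j
  | ARel s v => @rel P G s (fun j => e (v j))
  end.

(** Primitive positive definability: R(x_0..x_{n-1}) iff
    exists (the other variables), conjunction of atomic formulas. *)
Definition pp_definable (G : structure P) (n : nat) (R : ('I_n -> P) -> Prop)
  : Prop :=
  exists atoms : list (atom G), forall t : 'I_n -> P,
    R t <-> exists e : nat -> P,
      (forall i : 'I_n, e i = t i) /\ (forall a, List.In a atoms -> atom_sat e a).

Definition in_Pol2 (G : structure P) (f : P -> P -> P) : Prop :=
  forall (s : idx G) (t1 t2 : 'I_(ar s) -> P),
    @rel P G s t1 -> @rel P G s t2 -> @rel P G s (fun j => f (t1 j) (t2 j)).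

Variable le : P -> P -> Prop.

Definition embedding_lt2 (f : P -> P -> P) : Prop :=
  (forall a b a' b', f a b = f a' b' -> a = a' /\ b = b') /\
  (forall a b a' b', ltP le (f a b) (f a' b') <-> (ltP le a a' /\ ltP le b b')).

Definition embedding_le2 (f : P -> P -> P) : Prop :=
  (forall a b a' b', f a b = f a' b' -> a = a' /\ b = b') /\
  (forall a b a' b', le (f a b) (f a' b') <-> (le a a' /\ le b b')).

Definition o0_2 : 'I_2 := @Ordinal 2 0 isT.
Definition o1_2 : 'I_2 := @Ordinal 2 1 isT.
Definition o0_3 : 'I_3 := @Ordinal 3 0 isT.
Definition o1_3 : 'I_3 := @Ordinal 3 1 isT.
Definition o2_3 : 'I_3 := @Ordinal 3 2 isT.

Definition LtRel (t : 'I_2 -> P) : Prop := ltP le (t o0_2) (t o1_2).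
Definition IncompRel (t : 'I_2 -> P) : Prop := incompP le (t o0_2) (t o1_2).

Definition Low (x y z : P) : Prop :=
  (ltP le x y /\ incompP le z x /\ incompP le z y) \/
  (ltP le x z /\ incompP le y x /\ incompP le y z).
Definition LowRel (t : 'I_3 -> P) : Prop := Low (t o0_3) (t o1_3) (t o2_3).

End Reducts.

(* Main.v *)
From Stdlib Require Import List Classical ClassicalEpsilon FunctionalExtensionality.
Require Import Defs.
From mathcomp Require Import all_boot zify.
Set Implicit Arguments. Unset Strict Implicit. Unset Printing Implicit Defensive.

(** If [Low] is not primitive positive definable, a compactness argument yields a binary
    polymorphism [f] with [Low] violated at some points [p0], [p1], [p2] of [P * P], where
    [p0 -> p1] is of type (<, incomparable) and [p0 -> p2] of type (incomparable, <).  A polymorphism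
    preserves < and incomparability, so it maps such mixed pairs to < or to incomparable elements;
    hence [f p0] is either below both [f p1] and [f p2] or incomparable to both.

    The core is to make all mixed pairs of a finite set incomparable, one more at a time.  Embed grids
    [nat ^ d] (with finitely many levels recording the position relative to [p0], [p1], [p2]) into
    both arguments and apply Ramsey's theorem to each box of levels.  If in some box no mixed pair is
    mapped to <, we are done.  Otherwise transitivity shows that all boxes are dominated by the same
    argument, say the first, and then that every pair of type (incomparable, <) becomes incomparable,
    while the violation at [p0], [p1], [p2] still allows to make one chosen pair of type
    (<, incomparable) incomparable.  Composing such operations and using compactness gives a
    polymorphism [g] mapping all mixed pairs to incomparable elements.  For such a [g] only the values
    on pairs with one equal coordinate are undetermined, and they are all < for every such [g]
    (then [e_le] is a polymorphism) or can all be made incomparable (then [e_lt] is). *)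

Lemma choice (A B : Type) (R : A -> B -> Prop) :
  (forall x, exists y, R x y) -> exists f, forall x, R x (f x).
Proof.
move=> H; exists (fun x => proj1_sig (constructive_indefinite_description _ (H x))) => x.
exact: proj2_sig.
Qed.

Arguments choice [A B] R _.

(** * Ramsey's theorem *)

Definition increasing (h : nat -> nat) : Prop := forall i j, i < j -> h i < h j.

(** As [s] and [t] play symmetric roles, for increasing [h] this makes [chi] constant on the
    [k]-element subsets of the range of [h], listed increasingly. *)
Definition homogeneous (k : nat) (chi : seq nat -> Prop) (h : nat -> nat) : Prop :=
  forall s t, sorted ltn s -> sorted ltn t -> size s = k -> size t = k ->
    chi (map h s) -> chi (map h t).

Lemma increasing_comp h g : increasing h -> increasing g -> increasing (h \o g).
Proof. by move=> ih ig i j ij; apply/ih/ig. Qed.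

Lemma increasing_mono h : increasing h -> {mono h : i j / i < j}.
Proof.
move=> ih i j; case: (ltngtP i j) => [/ih -> //|/ih|->]; last by rewrite ltnn.
by case: (ltngtP (h i) (h j)).
Qed.

Lemma sorted_map_increasing h s : increasing h -> sorted ltn (map h s) = sorted ltn s.
Proof.
move=> ih; rewrite sorted_map; apply: eq_sorted => i j /=; exact: increasing_mono.
Qed.

Lemma homogeneous_comp k chi h g :
  increasing g -> homogeneous k chi h -> homogeneous k chi (h \o g).
Proof.
move=> ig hom s t ss st zs zt; rewrite !(map_comp h g).
by apply: hom; rewrite ?size_map ?sorted_map_increasing.
Qed.

Lemma infinite_pigeonhole (C : nat -> Prop) :
  exists h, increasing h /\ ((forall n, C (h n)) \/ (forall n, ~ C (h n))).
Proof.
case: (classic (forall m, exists n, m < n /\ C n)) => [inf|fin].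
  have [nx nxP] := choice _ inf.
  exists (fun n => iter n.+1 nx 0); split; last by left=> n /=; have [] := nxP (iter n nx 0).
  move=> i j; elim: j => // j IH; rewrite ltnS leq_eqVlt => /orP[/eqP->|/IH lij].
    by have [] := nxP (iter j.+1 nx 0).
  by apply: ltn_trans lij _; have [] := nxP (iter j.+1 nx 0).
have [m mP] := not_all_ex_not _ _ fin.
exists (fun n => n + m.+1); split; first by move=> i j; rewrite ltn_add2r.
by right=> n Cn; apply: mP; exists (n + m.+1); split=> //; lia.
Qed.

(** Induction on [k]: the diagonal [a] of successively thinned sequences makes the colour of a set
    of [k.+1] values depend only on its least element, and the pigeonhole principle fixes that
    colour on a subsequence. *)
Lemma ramsey k chi : exists h, increasing h /\ homogeneous k chi h.
Proof.
elim: k chi => [|k IHk] chi.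
  by exists id; split=> // s t _ _ /size0nil -> /size0nil ->.
have step (h : nat -> nat) : exists g, increasing g /\
    homogeneous k (fun s => chi (h 0 :: map (fun i => h i.+1) s)) g by apply: IHk.
have [G GP] := choice _ step.
have [H [H0 HS]] : exists H : nat -> nat -> nat,
    H 0 = id /\ forall n, H n.+1 = fun i => H n (G (H n) i).+1.
  by exists (fun n => iter n (fun h i => h (G h i).+1) id).
have incH n : increasing (H n).
  elim: n => [|n IH]; first by rewrite H0.
  by rewrite HS => i j ij; apply: IH; rewrite ltnS; have [+ _] := GP (H n); apply.
pose a n := H n 0.
have rangeH i : forall j x, exists y, H (j + i) x = H i y.
  by elim=> [|j IH] x; [exists x | rewrite addSn HS; apply: IH].
have inca : increasing a.
  move=> i j; elim: j => // j IH; rewrite ltnS leq_eqVlt => lij.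
  have lj : a j < a j.+1 by rewrite /a HS; apply: incH.
  by case/orP: lij => [/eqP-> //|/IH/ltn_trans]; apply.
have mapa i s : all (ltn i) s -> exists t, map a s = map (H i.+1) t.
  elim: s => [|j s IH] /=; first by exists [::].
  case/andP=> ij /IH [t ->].
  have [y e] := rangeH i.+1 (j - i.+1) 0; rewrite subnK // in e.
  by exists (y :: t); rewrite /= -e.
(* [C i] is the colour attached to [a i]; by [CP] it can be read off any set of later elements. *)
pose C i := exists s, [/\ sorted ltn s, all (ltn i) s, size s = k & chi (a i :: map a s)].
have CP i s : C i -> sorted ltn s -> all (ltn i) s -> size s = k -> chi (a i :: map a s).
  move=> [t [st at_ zt ct]] ss als zs.
  have [t' et] := mapa i t at_; have [s' es] := mapa i s als.
  have [_ hom] := GP (H i).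
  have mH r : map (H i.+1) r = map (fun x => H i x.+1) (map (G (H i)) r) by rewrite -map_comp HS.
  rewrite es mH; apply: (hom t').
  - by rewrite -(sorted_map_increasing _ (incH i.+1)) -et sorted_map_increasing.
  - by rewrite -(sorted_map_increasing _ (incH i.+1)) -es sorted_map_increasing.
  - by rewrite -zt -(size_map a t) et size_map.
  - by rewrite -zs -(size_map a s) es size_map.
  - by rewrite -mH -et.
have [h [inch hC]] := infinite_pigeonhole C.
exists (a \o h); split; first exact: increasing_comp.
have above i s : path ltn i s -> all (ltn (h i)) (map h s) /\ sorted ltn (map h s).
  move=> p; split; last by rewrite sorted_map_increasing //; apply: path_sorted p.
  rewrite all_map; apply: sub_all (order_path_min ltn_trans p) => j; exact: inch.
move=> [|i s] [|j t] //= ps pt [zs] [zt]; rewrite !(map_comp a h) => ch.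
have [as_ ss] := above _ _ ps; have [at_ st] := above _ _ pt.
case: hC => hC; first by apply: CP; rewrite ?size_map.
by case: (hC i); exists (map h s); split; rewrite ?size_map.
Qed.

Lemma ramsey_family (T : finType) k (chi : T -> seq nat -> Prop) :
  exists h, increasing h /\ forall x, homogeneous k (chi x) h.
Proof.
suff [h [ih hP]] : exists h, increasing h /\ forall x, x \in enum T -> homogeneous k (chi x) h.
  by exists h; split=> // x; apply: hP; rewrite mem_enum.
elim: (enum T) => [|x s [h [ih hP]]]; first by exists id; split.
have [g [ig gP]] := ramsey k (fun s => chi x (map h s)).
exists (h \o g); split; first exact: increasing_comp.
move=> y; rewrite inE => /orP[/eqP->|/hP]; last exact: homogeneous_comp.
by move=> t t' st st' zt zt'; rewrite !(map_comp h g); apply: gP.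
Qed.

(** * Canonical behaviour on grids *)

(** Incomparability in the product order on [nat ^ I]. *)
Definition crossing (I : Type) (x y : I -> nat) : Prop :=
  (exists i, x i < y i) /\ (exists i, y i < x i).

Section Grid.

Variables (T : Type) (lt : T -> T -> Prop) (d : nat) (L : finType) (leL : L -> L -> Prop) (bot : L).
Hypothesis lt_trans : forall x y z, lt x y -> lt y z -> lt x z.
Hypothesis leL_bot : forall l, leL bot l.

Local Notation coords := (bool -> 'I_d -> nat).
Local Notation levels := (bool -> L).

(** The boolean names an argument of a binary operation: [F n l] stands for its value at the two
    grid points with coordinates [n b] and levels [l b]. *)
Variable F : coords -> levels -> T.
Hypothesis F_mono : forall n n' l l', (forall b i, n b i < n' b i) ->
  (forall b, leL (l b) (l' b)) -> lt (F n l) (F n' l').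
Hypothesis F_cross : forall n n' l l', (forall b, crossing (n b) (n' b)) ->
  ~ lt (F n l) (F n' l').

Definition has_pattern (E : bool -> 'I_d -> bool) (n n' : coords) : Prop :=
  forall b i, if E b i then n b i < n' b i else n' b i < n b i.

Definition bounded (M : nat) (n : coords) : Prop := forall b i, n b i < M.

Definition rescale (theta : bool -> 'I_d -> nat -> nat) (n : coords) : coords :=
  fun b i => theta b i (n b i).

(* Each coordinate takes its values in its own block of a homogeneous set, so that the order type
   of a pair of points is exactly its pattern. *)
Lemma canonical_grid M : exists theta : bool -> 'I_d -> nat -> nat,
  (forall b i, increasing (theta b i)) /\
  forall l E n n' m m', bounded M n -> bounded M n' -> bounded M m -> bounded M m' ->
    has_pattern E n n' -> has_pattern E m m' ->
    lt (F (rescale theta n) l) (F (rescale theta n') l) ->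
    lt (F (rescale theta m) l) (F (rescale theta m') l).
Proof.
pose pos (b : bool) (i : 'I_d) : nat := b * d + i.
(* [v] lists two values for every coordinate, the smaller one first. [low v E] takes the smaller one
   exactly where [E] holds, so together with [low v] of the negated pattern it forms a pair of
   pattern [E]. *)
pose low (v : seq nat) (E : bool -> 'I_d -> bool) : coords :=
  fun b i => nth 0 v ((pos b i).*2 + ~~ E b i).
pose C := ({ffun bool -> L} * {ffun bool * 'I_d -> bool})%type.
pose chi (c : C) (v : seq nat) : Prop :=
  lt (F (low v (fun b i => c.2 (b, i))) c.1) (F (low v (fun b i => ~~ c.2 (b, i))) c.1).
pose ext (n : coords) (c : nat) : nat :=
  let b := d <= c in if insub (c - b * d) is Some i then n b i else 0.
have posP b i : pos b i < 2 * d by rewrite /pos; case: b; have := ltn_ord i; lia.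
have extE n b i : ext n (pos b i) = n b i.
  have eb : (d <= pos b i) = b by rewrite /pos; case: b; have := ltn_ord i; lia.
  by rewrite /ext eb /pos addKn valK.
have posE c : c < 2 * d -> exists b i, c = pos b i.
  move=> ltc; case: (leqP d c) => cd.
    have ltk : c - d < d by lia.
    by exists true, (Ordinal ltk); rewrite /pos /=; lia.
  by exists false, (Ordinal cd).
have [h [ih hP]] := ramsey_family (2 * d).*2 chi.
exists (fun b i j => h (pos b i * M + j)); split=> [b i j k jk|].
  by apply: ih; rewrite ltn_add2l.
(* The summand [k./2 * M] moves the coordinates into disjoint blocks, so that two bounded points
   with a pattern yield a strictly sorted sequence. *)
pose v n n' := mkseq (fun k => k./2 * M +
  (if odd k then maxn else minn) (ext n k./2) (ext n' k./2)) (2 * d).*2.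
have vsorted E n n' : bounded M n -> bounded M n' -> has_pattern E n n' -> sorted ltn (v n n').
  move=> bn bn' pn; apply/(sortedP 0) => k; rewrite size_mkseq => ltk.
  rewrite !nth_mkseq //; last by apply: ltnW.
  have [|b [i ck]] := posE k./2; first by lia.
  rewrite [k.+1./2]/= uphalf_half ck /=.
  have := pn b i; have := bn b i; have := bn' b i; case: (odd k) => /=.
    rewrite extE extE mulnDl mul1n => ? ? ?.
    by apply: leq_trans (_ : pos b i * M + M <= _); [rewrite ltn_add2l gtn_max; apply/andP | lia].
  by rewrite add0n !extE; case: (E b i); lia.
have lowv E n n' : has_pattern E n n' ->
    low (map h (v n n')) E = rescale (fun b i j => h (pos b i * M + j)) n /\
    low (map h (v n n')) (fun b i => ~~ E b i) = rescale (fun b i j => h (pos b i * M + j)) n'.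
  move=> pn; split; apply: functional_extensionality => b;
    apply: functional_extensionality => i; rewrite /low /rescale;
    (rewrite (nth_map 0); last by rewrite size_mkseq; have := posP b i; case: (E b i) => /=; lia);
    (rewrite nth_mkseq; last by have := posP b i; case: (E b i) => /=; lia);
    have := pn b i; case: (E b i) => /= lt_n; congr (h _);
    rewrite ?addn0 ?addn1 /= ?uphalf_double ?doubleK ?oddS ?odd_double /= !extE; lia.
move=> l E n n' m m' bn bn' bm bm' pn pm.
have [en en'] := lowv _ _ _ pn; have [em em'] := lowv _ _ _ pm.
pose c : C := ([ffun b => l b], [ffun x => E x.1 x.2]).
have c1 : (c.1 : levels) = l by apply: functional_extensionality => b; rewrite ffunE.
have c2 : (fun b i => c.2 (b, i)) = E.
  by do 2!apply: functional_extensionality => ?; rewrite ffunE.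
have := hP c (v n n') (v m m') (vsorted _ _ _ bn bn' pn) (vsorted _ _ _ bm bm' pm).
rewrite !size_mkseq /chi => /(_ erefl erefl).
have c2' : (fun b i => ~~ c.2 (b, i)) = (fun b i => ~~ E b i).
  by do 2!apply: functional_extensionality => ?; rewrite ffunE.
by rewrite c1 c2 c2' en en' em em'.
Qed.

Lemma crossing_rescale theta n n' b : (forall c i, increasing (theta c i)) ->
  crossing (n b) (n' b) -> crossing (rescale theta n b) (rescale theta n' b).
Proof. by move=> inc [[i li] [j lj]]; split; [exists i | exists j]; apply: inc. Qed.

(** Argument [b] prevails over the other one for at least one pattern [e]; the first two conditions
    force a crossing in the other argument. *)
Definition dominated (theta : bool -> 'I_d -> nat -> nat) (M : nat) (b : bool) (l : levels) : Prop :=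
  exists e : 'I_d -> bool, [/\ exists i, e i, exists i, ~~ e i &
    forall m m', bounded M m -> bounded M m' -> (forall i, m b i < m' b i) ->
      (forall i, if e i then m (~~ b) i < m' (~~ b) i else m' (~~ b) i < m (~~ b) i) ->
      lt (F (rescale theta m) l) (F (rescale theta m') l)].

(** A chain [t < p < q < r] arises: its outer steps come from the two dominations, its middle step
    from growth in both arguments. Yet [t] and [r] cross in both arguments. Only the order of the
    values 0, 5, 10, 20, 25, 30 matters. *)
Lemma dominated_conflict theta M b l : 31 <= M -> (forall c i, increasing (theta c i)) ->
  dominated theta M b (fun=> bot) -> dominated theta M (~~ b) l -> False.
Proof.
move=> M31 inc [e [[i ei] [j ej] eP]] [e' [[i' ei'] [j' ej'] eP']].
pose mix (x y : 'I_d -> nat) : coords := fun c k => if c == b then x k else y k.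
have mb x y : mix x y b = x by rewrite /mix eqxx.
have mn x y : mix x y (~~ b) = y by rewrite /mix; case: (b).
have mixP (x y : 'I_d -> nat) : (forall k, x k < 31) -> (forall k, y k < 31) -> bounded M (mix x y).
  by move=> bx by_ c k; apply: leq_trans M31; rewrite /mix; case: ifP.
pose p := mix (fun=> 10) (fun=> 10); pose q := mix (fun=> 20) (fun=> 20).
pose t := mix (fun=> 5) (fun k => if e k then 5 else 30).
pose r := mix (fun k => if e' k then 30 else 0) (fun=> 25).
have tp : lt (F (rescale theta t) (fun=> bot)) (F (rescale theta p) (fun=> bot)).
  apply: eP; try by apply: mixP => k //; case: ifP.
    by move=> k; rewrite /t /p !mb.
  by move=> k; rewrite /t /p !mn; case: (e k).
have qr : lt (F (rescale theta q) l) (F (rescale theta r) l).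
  apply: eP'; try by apply: mixP => k //; case: ifP.
    by move=> k; rewrite /q /r !mn.
  by move=> k; rewrite /q /r negbK !mb; case: (e' k).
have pq : lt (F (rescale theta p) (fun=> bot)) (F (rescale theta q) l).
  by apply: F_mono => // c k; apply: inc; rewrite /p /q /mix; case: ifP.
apply: (F_cross (n := rescale theta t) (n' := rescale theta r) (l := fun=> bot) (l' := l)); last first.
  exact: lt_trans tp (lt_trans pq qr).
move=> c; apply: crossing_rescale => //; rewrite /t /r.
have [->|->] : c = b \/ c = ~~ b by case: (c); case: (b); [left|right|right|left].
  by rewrite !mb; split; [exists i' | exists j']; rewrite ?ei' ?(negbTE ej').
by rewrite !mn; split; [exists i | exists j]; rewrite ?ei ?(negbTE ej).
Qed.

(** If domination occurs at every level, the argument dominating at [bot] dominates everywhere by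
    [dominated_conflict]. Transitivity then excludes [<] for pairs that cross in that argument, even
    between different levels. *)
Lemma grid_dichotomy M : exists theta : bool -> 'I_d -> nat -> nat,
  (forall b i, increasing (theta b i)) /\
  ((exists l, forall b n n', bounded M n -> bounded M n' ->
      (forall i, n b i < n' b i) -> crossing (n (~~ b)) (n' (~~ b)) ->
      (forall i, n (~~ b) i <> n' (~~ b) i) ->
      ~ lt (F (rescale theta n) l) (F (rescale theta n') l)) \/
   (exists b, forall l l' n n', bounded M n -> bounded M n' ->
      crossing (n b) (n' b) -> (forall i, n (~~ b) i < n' (~~ b) i) ->
      ~ lt (F (rescale theta n) l) (F (rescale theta n') l'))).
Proof.
pose M' := M.*2 + 40.
have [th [inc hom]] := canonical_grid M'.
(* Spreading the grid leaves a free value just below each coordinate and, with the 40 extra values,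
   room above all of them. *)
pose sp (n : coords) : coords := fun b i => (n b i).*2.+2.
exists (fun b i j => th b i j.*2.+2); split=> [b i j k jk|]; first by apply: inc; lia.
have spE n : rescale (fun b i j => th b i j.*2.+2) n = rescale th (sp n) by [].
have bsp n : bounded M n -> bounded M' (sp n).
  by move=> bn b i; have := bn b i; rewrite /sp /M'; lia.
have [[l lP]|nl] := classic (exists l, forall b, ~ dominated th M' b l).
  (* By homogeneity, a single mixed pair mapped to [<] would already be a domination. *)
  left; exists l => b n n' bn bn' ltb [[i li] [j lj]] ne; rewrite !spE => ltF.
  apply: (lP b); exists (fun k => n (~~ b) k < n' (~~ b) k); split; first by exists i.
    by exists j; rewrite -leqNgt ltnW.
  move=> m m' bm bm' ltm pm.
  apply: (hom l (fun c k => n c k < n' c k) _ _ _ _ (bsp _ bn) (bsp _ bn') bm bm' _ _ ltF) => c k.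
    have [->|->] : c = b \/ c = ~~ b by case: (c); case: (b); [left|right|right|left].
      by rewrite /= ltb /sp; have := ltb k; lia.
    by have := ne k; rewrite /= /sp; case: ltngtP => //; lia.
  have [->|->] : c = b \/ c = ~~ b by case: (c); case: (b); [left|right|right|left].
    by rewrite /= ltb.
  exact: pm.
right; have dom l : exists b, dominated th M' b l.
  apply: NNPP => H; apply: nl; exists l => b Hb; apply: H; by exists b.
have [b domb] := dom (fun=> bot).
have M31 : 31 <= M' by rewrite /M'; lia.
exists b => l l' n n' bn bn' [[i li] [j lj]] ltnb; rewrite !spE => ltF.
have {dom} [e [[i' ei'] [j' ej'] eP]] : dominated th M' b l.
  have [c domc] := dom l.
  have [e|e] : c = b \/ c = ~~ b by case: (c); case: (b); [left|right|right|left].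
    by rewrite -e.
  by case: (dominated_conflict M31 inc domb (l := l)); rewrite -e.
(* [t] sits just below [n], except that it moves to the top in those coordinates of the other
   argument where [e] fails: it is dominated by [n] but crosses [n'] in both arguments. *)
pose t : coords := fun c k =>
  if (c == b) || e k then (n c k).*2.+1 else M.*2 + 39.
have bt : bounded M' t.
  by move=> c k; have := bn c k; rewrite /t /M'; case: ifP => _; lia.
have ltt : lt (F (rescale th t) l) (F (rescale th (sp n)) l).
  apply: eP => // [|k|k]; first exact: bsp.
    by rewrite /t eqxx.
  rewrite /t /sp; have -> : (~~ b == b) = false by case: (b).
  by case: (e k) => //=; have := bn (~~ b) k; lia.
apply: (F_cross (n := rescale th t) (n' := rescale th (sp n')) (l := l) (l' := l')); last first.
  exact: lt_trans ltt ltF.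
move=> c; apply: crossing_rescale => //; rewrite /t /sp.
have [->|->] : c = b \/ c = ~~ b by case: (c); case: (b); [left|right|right|left].
  by split; [exists i | exists j]; rewrite eqxx /=; lia.
have nbb : (~~ b == b) = false by case: (b).
split; [exists i' | exists j']; rewrite nbb /= ?ei' ?(negbTE ej').
  by have := ltnb i'; lia.
by have := bn' (~~ b) j'; lia.
Qed.

End Grid.

(** * Embeddings into the random partial order *)

Lemma In_memP (T : eqType) (x : T) (s : seq T) : reflect (In x s) (x \in s).
Proof.
apply: (iffP idP); elim: s => //= y s IH; rewrite inE.
  by case/orP => [/eqP->|/IH]; [left | right].
by case=> [->|/IH ->]; rewrite ?eqxx ?orbT.
Qed.

(** For an antisymmetric [le], mutual [le] encodes equality, so this is equality of quantifier-free
    types. *)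
Definition same_type (P : Type) (le : P -> P -> Prop) (I : Type) (t t' : I -> P) : Prop :=
  forall i j, le (t i) (t j) <-> le (t' i) (t' j).

Definition order_embedding (P : Type) (le : P -> P -> Prop) (alpha : P -> P) : Prop :=
  forall x y, le (alpha x) (alpha y) <-> le x y.

Section RandomPoset.

Variables (P : Type) (le : P -> P -> Prop).
Hypothesis HP : random_po le.

Local Notation lt := (Defs.ltP le).
Local Notation inc := (incompP le).

Lemma po_refl x : le x x.
Proof. by case: HP. Qed.

Lemma po_anti x y : le x y -> le y x -> x = y.
Proof. by case: HP => _ + _ _ _; apply. Qed.

Lemma po_trans x y z : le x y -> le y z -> le x z.
Proof. by case: HP => _ _ + _ _; apply. Qed.

Lemma po_lt_le_trans x y z : lt x y -> le y z -> lt x z.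
Proof.
move=> [xy nxy] yz; split; first exact: po_trans yz.
by move=> e; apply: nxy; apply: po_anti => //; rewrite e.
Qed.

Lemma po_le_lt_trans x y z : le x y -> lt y z -> lt x z.
Proof.
move=> xy [yz nyz]; split; first exact: po_trans yz.
by move=> e; apply: nyz; apply: po_anti => //; rewrite -e.
Qed.

Lemma po_lt_trans x y z : lt x y -> lt y z -> lt x z.
Proof. by move=> xy [yz _]; apply: po_lt_le_trans yz. Qed.

Lemma po_ltNge x y : lt x y -> ~ le y x.
Proof. by move=> [xy nxy] yx; apply: nxy; apply: po_anti. Qed.

Lemma po_inc_sym x y : inc x y -> inc y x.
Proof. by case. Qed.

Lemma po_cases x y : [\/ x = y, lt x y, lt y x | inc x y].
Proof.
case: (classic (x = y)) => [->|nxy]; first by apply: Or41.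
case: (classic (le x y)) => xy; first by apply: Or42.
case: (classic (le y x)) => yx; last by apply: Or44.
by apply: Or43; split=> // e; apply: nxy.
Qed.

Definition embeds_on (X : Type) (R : X -> X -> Prop) (E : list X) (phi : X -> P) : Prop :=
  forall x y, In x E -> In y E -> (le (phi x) (phi y) <-> R x y).

Section Embedding.

Variables (X : Type) (R : X -> X -> Prop).
Hypothesis R_refl : forall x, R x x.
Hypothesis R_trans : forall x y z, R x y -> R y z -> R x z.

(** [R] is only a preorder, so [x] may be equivalent to a point of [E] and then shares its image;
    otherwise the extension property realises the cut of [x] over the images. *)
Lemma embeds_on_extend E phi x : embeds_on R E phi ->
  exists psi, (forall y, In y E -> psi y = phi y) /\ embeds_on R (x :: E) psi.
Proof.
move=> emb; case: (classic (In x E)) => [xE|nxE].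
  by exists phi; split=> // y z [<-|yE] [<-|zE]; apply: emb.
suff [p pP] : exists p, forall y, In y E -> (le (phi y) p <-> R y x) /\ (le p (phi y) <-> R x y).
  pose psi z := if excluded_middle_informative (z = x) then p else phi z.
  have psix : psi x = p by rewrite /psi; case: excluded_middle_informative.
  have psiE y : In y E -> psi y = phi y.
    by rewrite /psi; case: excluded_middle_informative => // e yE; case: nxE; rewrite -e.
  exists psi; split=> // y z [<-|yE] [<-|zE]; rewrite ?psix ?psiE //.
  - by split=> _; [apply: R_refl | apply: po_refl].
  - by have [] := pP z zE.
  - by have [] := pP y yE.
  - exact: emb.
case: (classic (exists y, [/\ In y E, R x y & R y x])) => [[y [yE xy yx]]|nE].
  exists (phi y) => z zE; split.
    by rewrite emb //; split=> [zy|zx]; [apply: R_trans yx | apply: R_trans xy].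
  by rewrite emb //; split=> [yz|xz]; [apply: R_trans yz | apply: R_trans xz].
have [_ _ _ _ ext] := HP.
have [|||| p [_ pP]] := ext (map phi E) (fun a => exists y, [/\ In y E, phi y = a & R y x])
    (fun a => exists y, [/\ In y E, phi y = a & R x y]).
- move=> a _ [[y [yE <- yx]] [z [zE ez xz]]]; apply: nE; exists y; split=> //.
  by apply: R_trans xz _; apply/emb => //; rewrite ez; apply: po_refl.
- move=> a a' /in_map_iff [y [<- yE]] _ yz [z [zE ez zx]]; exists y; split=> //.
  by apply: R_trans zx; apply/emb => //; rewrite ez.
- move=> a a' _ /in_map_iff [y [<- yE]] zy [z [zE ez xz]]; exists y; split=> //.
  by apply: R_trans xz _; apply/emb => //; rewrite ez.
- move=> a a' _ _ [y [yE <- yx]] [z [zE <- xz]].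
  by apply/emb => //; apply: R_trans xz.
exists p => y yE; have [-> ->] := pP (phi y) (in_map phi _ _ yE).
split; split=> [[z [zE ez]]|]; try by exists y.
  by move=> zx; apply: R_trans zx; apply/emb => //; rewrite ez; apply: po_refl.
by move=> xz; apply: R_trans xz _; apply/emb => //; rewrite ez; apply: po_refl.
Qed.

Lemma embed_countable (code : X -> nat) A phi0 : injective code -> embeds_on R A phi0 ->
  exists phi, (forall x, In x A -> phi x = phi0 x) /\ forall x y, le (phi x) (phi y) <-> R x y.
Proof.
move=> code_inj emb0.
have [D DP] : exists D : nat -> option X, forall n x, code x = n -> D n = Some x.
  apply: (choice (fun n o => forall x, code x = n -> o = Some x)) => n; case: (classic (exists x, code x = n)) => [[x <-]|H].
    by exists (Some x) => y /code_inj ->.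
  by exists None => x xn; case: H; exists x.
have [G GP] : exists G : (list X * (X -> P)) * X -> (X -> P), forall s, embeds_on R s.1.1 s.1.2 ->
    (forall y, In y s.1.1 -> G s y = s.1.2 y) /\ embeds_on R (s.2 :: s.1.1) (G s).
  apply: (choice (fun s g => embeds_on R s.1.1 s.1.2 ->
    (forall y, In y s.1.1 -> g y = s.1.2 y) /\ embeds_on R (s.2 :: s.1.1) g)) => -[[E phi] x] /=; case: (classic (embeds_on R E phi)) => [/(@embeds_on_extend _ _ x)|H].
    by move=> [psi psiP]; exists psi.
  by exists phi.
pose step n s := if D n is Some x then (x :: s.1, G (s, x)) else s : list X * (X -> P).
pose st := fix st n := if n is m.+1 then step m (st m) else (A, phi0).
have emb n : embeds_on R (st n).1 (st n).2.
  elim: n => //= n IH; rewrite /step; case: (D n) => // x.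
  by have [] := GP (st n, x) IH.
have mono n m x : In x (st n).1 -> In x (st (m + n)).1 /\ (st (m + n)).2 x = (st n).2 x.
  move=> xn; elim: m => // m [IH1 IH2]; rewrite addSn /= /step; case: (D _) => // y.
  have [/= GE _] := GP (st (m + n), y) (emb _).
  by split; [right | rewrite GE].
have inS x : In x (st (code x).+1).1 by rewrite /= /step (DP _ x) //=; left.
(* Later stages never change the value at [x], so the stage following [code x] decides it. *)
pose phi x := (st (code x).+1).2 x.
have phiE x n : code x < n -> In x (st n).1 /\ (st n).2 x = phi x.
  by move=> lt_n; have := mono _ (n - (code x).+1) _ (inS x); rewrite subnK.
exists phi; split=> [x xA|x y].
  by have := mono 0 (code x).+1 x xA; rewrite addn0 => -[].
pose n := (maxn (code x) (code y)).+1.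
have [xn <-] := phiE x n (leq_maxl _ _ : code x < n).
have [yn <-] := phiE y n (leq_maxr _ _ : code y < n).
exact: emb.
Qed.

End Embedding.

(** Homogeneity in one-sided form: extending along an enumeration of [P] yields a self-embedding. *)
Lemma order_embedding_extend n (u v : 'I_n -> P) : same_type le u v ->
  exists alpha, order_embedding le alpha /\ forall i, alpha (u i) = v i.
Proof.
move=> uv; have [_ _ _ [code code_inj] _] := HP.
have [phi0 phi0P] : exists phi0 : P -> P, forall x i, u i = x -> phi0 x = v i.
  apply: (choice (fun x y => forall i, u i = x -> y = v i)) => x; case: (classic (exists i, u i = x)) => [[i <-]|H].
    by exists (v i) => j eij; apply: po_anti; apply/uv; rewrite eij; apply: po_refl.
  by exists x => i ui; case: H; exists i.
have [|alpha [aP aE]] := @embed_countable P le po_refl po_trans code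
  (map u (enum 'I_n)) phi0 code_inj.
  move=> x y /in_map_iff [i [<- _]] /in_map_iff [j [<- _]].
  by rewrite (phi0P _ i) // (phi0P _ j) //; split=> /uv.
exists alpha; split=> // i; rewrite aP; first exact: phi0P.
apply/in_map_iff; exists i; split=> //.
by apply/In_memP; rewrite mem_enum.
Qed.

Lemma exists_above_inc a b : ~ le b a -> exists z, lt a z /\ inc z b.
Proof.
move=> nba; have [_ _ _ _ ext] := HP.
have [||||z [nz zP]] := ext [:: a; b] (fun x => le x a) (fun=> False).
- by move=> x _ [].
- by move=> x y _ _ xy ya; apply: po_trans ya.
- by [].
- by [].
have [aza zaF] := zP a (or_introl erefl); have [bz zb] := zP b (or_intror (or_introl erefl)).
exists z; split; last by split=> [/zb|/bz].
by split; [apply/aza/po_refl | move=> e; apply: nz; left].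
Qed.

Lemma exists_below_inc a b : ~ le a b -> exists z, lt z a /\ inc z b.
Proof.
move=> nab; have [_ _ _ _ ext] := HP.
have [||||z [nz zP]] := ext [:: a; b] (fun=> False) (fun x => le a x).
- by move=> x _ [].
- by [].
- by move=> x y _ _ xy ay; apply: po_trans ay xy.
- by [].
have [aza zaF] := zP a (or_introl erefl); have [bz zb] := zP b (or_intror (or_introl erefl)).
exists z; split; last by split=> [/zb|/bz].
by split; [apply/zaF/po_refl | move=> e; apply: nz; left].
Qed.

Lemma exists_below x : exists z, lt z x.
Proof.
have [_ _ _ _ ext] := HP.
have [||||z [nz zP]] := ext [:: x] (fun=> False) (fun y => le x y).
- by move=> y _ [].
- by [].
- by move=> y z _ _ yz xy; apply: po_trans xy yz.
- by [].
exists z; have [_ zx] := zP x (or_introl erefl).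
by split; [apply/zx/po_refl | move=> e; apply: nz; left].
Qed.

Lemma exists_fork : exists a b c, [/\ lt a b, inc c a & inc c b].
Proof.
have [_ _ _ _ ext] := HP.
have [||||p _] := ext nil (fun=> False) (fun=> False); try by [].
pose R (k l : nat) := k = l \/ k = 0 /\ l = 1.
have [|||phi [_ phiP]] := @embed_countable nat R _ _ id nil (fun=> p) (fun _ _ => id).
- by left.
- by rewrite /R => x y z; lia.
- by [].
exists (phi 0), (phi 1), (phi 2).
have e k l : phi k = phi l -> R k l by move=> kl; apply/phiP; rewrite kl; apply: po_refl.
split; split; rewrite ?phiP /R; try lia.
by move/esym/e; rewrite /R; lia.
Qed.

(** * First-order formulas and quantifier-free types *)

Fixpoint var_bound (phi : fo) : nat :=
  match phi with
  | FLe i j | FEq i j => maxn i.+1 j.+1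
  | FNot p => var_bound p
  | FAnd p q => maxn (var_bound p) (var_bound q)
  | FEx i p => maxn i.+1 (var_bound p)
  end.

(** Induction on [phi]; at a quantifier, a witness for [e] is matched by a point of the same type
    over [e']. The old value of the quantified variable [i] is forgotten, hence the list [E] without
    [i]. *)
Lemma sat_same_type N phi (e e' : nat -> P) : var_bound phi <= N ->
  (forall i j, i < N -> j < N -> (le (e i) (e j) <-> le (e' i) (e' j))) ->
  sat le e phi -> sat le e' phi.
Proof.
elim: phi e e' => /= [i j|i j|p IH|p IHp q IHq|i p IH] e e'; rewrite ?geq_max.
- by case/andP=> iN jN /(_ i j iN jN) ->.
- case/andP=> iN jN ee eij.
  by apply: po_anti; apply/ee => //; rewrite eij; apply: po_refl.
- by move=> pN ee np pe'; apply: np; apply: IH pe' => // i j iN jN; symmetry; apply: ee.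
- by case/andP=> pN qN ee [pe qe]; split; [apply: IHp pe | apply: IHq qe].
case/andP=> iN pN ee [x px].
pose eu k := if k == i then x else e k.
pose E := filter (fun k => k != i) (iota 0 N).
have EP k : In k E -> (k < N) * (k == i = false).
  by move/In_memP; rewrite mem_filter mem_iota add0n => /andP[/negbTE -> /andP[_ ->]].
have PE k : k < N -> k <> i -> In k E.
  by move=> kN ki; apply/In_memP; rewrite mem_filter mem_iota add0n kN leq0n !andbT; apply/eqP.
have [||| psi [psiE psiP]] := @embeds_on_extend nat (fun k l => le (eu k) (eu l)) _ _ E e' i.
- by move=> k; apply: po_refl.
- by move=> k l m; apply: po_trans.
- by move=> k l /EP[kN ki] /EP[lN li]; rewrite /eu ki li; symmetry; apply: ee.
exists (psi i); apply: (IH eu) => // k l kN lN.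
have eqpsi m : m < N -> In m (i :: E) /\ (if m == i then psi i else e' m) = psi m.
  move=> mN; case: eqP => [->|/(PE m mN) mE]; first by split=> //; left.
  by split; [right | rewrite psiE].
have [kE ->] := eqpsi k kN; have [lE ->] := eqpsi l lN.
by symmetry; apply: psiP.
Qed.

Lemma fo_definable_same_type n (R : ('I_n -> P) -> Prop) t t' :
  fo_definable le R -> same_type le t t' -> R t -> R t'.
Proof.
case: n R t t' => [|n] R t t' [phi phiP] tt' Rt.
  by have -> : t' = t by apply: functional_extensionality; case.
(* Variables that are not arguments get the value of argument 0, so the assignment takes values in
   the tuple only; the empty tuple, which is unique, was split off before. *)
pose ev (s : 'I_n.+1 -> P) k := if insub k is Some i then s i else s ord0.
have evE s (i : 'I_n.+1) : ev s i = s i by rewrite /ev valK.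
apply/(phiP _ (ev t')) => //; move/(phiP _ (ev t) (evE t)): Rt.
apply: (@sat_same_type (var_bound phi)) => // k l _ _; rewrite /ev.
by case: (insub k) => [i|]; case: (insub l) => [j|]; apply: tt'.
Qed.

(** * Compactness for binary operations *)

(* The order between the values of the sought operation is decided one pair of points at a time,
   keeping all finite sets of conditions satisfiable. *)
Lemma binary_compactness (I : Type) (C : I -> (P -> P -> P) -> Prop) :
  (forall i, exists B : list P, forall g g',
    (forall x y x' y', In x B -> In y B -> In x' B -> In y' B ->
      (le (g x y) (g x' y') <-> le (g' x y) (g' x' y'))) -> C i g -> C i g') ->
  (forall K : list I, exists g, forall i, In i K -> C i g) ->
  exists g, forall i, C i g.
Proof.
move=> supp fin; have [_ _ _ [cd cd_inj] _] := HP.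
pose code (p q : P * P) := pickle (cd p.1, cd p.2, (cd q.1, cd q.2)).
have code_inj p q p' q' : code p q = code p' q' -> p = p' /\ q = q'.
  move/(pcan_inj pickleK) => [/cd_inj e1 /cd_inj e2 /cd_inj e3 /cd_inj e4].
  by case: p p' q q' e1 e2 e3 e4 => [? ?] [? ?] [? ?] [? ?] /= -> -> -> ->.
pose app (g : P -> P -> P) p := g p.1 p.2.
pose agrees g n (S : nat -> Prop) :=
  forall p q, code p q < n -> (le (app g p) (app g q) <-> S (code p q)).
pose con n S := forall K : list I, exists g, (forall i, In i K -> C i g) /\ agrees g n S.
pose upd (S : nat -> Prop) n A m := if m == n then A else S m.
(* Stage [m] puts the pair with code [m] into the order exactly when all finite sets of conditions
   remain satisfiable. *)
pose D := fix D n := if n is m.+1 then upd (D m) m (con m.+1 (upd (D m) m True)) else fun=> False.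
have conD n : con n (D n).
  elim: n => [|n IH] K; first by have [g gP] := fin K; exists g.
  rewrite /=; set A := con _ _.
  case: (classic A) => [hA|nA].
    have [g [gP ag]] := hA K; exists g; split=> // p q lt_pq; rewrite (ag p q lt_pq) /upd.
    by case: eqP.
  (* [K0] refutes the positive choice, so any solution of [K ++ K0] makes the negative one. *)
  have [K0 K0P] := not_all_ex_not _ _ nA.
  have [g [gP ag]] := IH (K ++ K0); exists g; split=> [i iK|p q].
    by apply: gP; apply: in_or_app; left.
  rewrite ltnS leq_eqVlt /upd; case: eqP => [pq _|_ /ag //]; split=> // lepq.
  case: K0P; exists g; split=> [i iK|p' q']; first by apply: gP; apply: in_or_app; right.
  rewrite ltnS leq_eqVlt /upd; case: eqP => [pq' _|_ /ag //].
  by rewrite -pq in pq'; have [-> ->] := code_inj _ _ _ _ pq'.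
have Dstable m k : D (m + k.+1) k <-> D k.+1 k.
  by elim: m => // m IH; rewrite addSn [D _]/= /upd; case: eqP => // e; lia.
have DE n k : k < n -> (D n k <-> D k.+1 k).
  by move=> kn; have := Dstable (n - k.+1) k; rewrite subnK.
pose R p q := D (code p q).+1 (code p q).
have witness n K : exists g, (forall i, In i K -> C i g) /\
    forall p q, code p q < n -> (le (app g p) (app g q) <-> R p q).
  have [g [gP ag]] := conD n K; exists g; split=> // p q lt_pq.
  by rewrite ag // DE.
(* Any three points see [R] through one common witness, so [R] is a preorder; its embedding into [P]
   is the operation sought. *)
have [||||phi [_ phiP]] := @embed_countable (P * P) R _ _ (fun p => pickle (cd p.1, cd p.2)) nil (fun p => p.1).
- move=> p; have [g [_ gP]] := witness (code p p).+1 nil.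
  by apply/gP => //; apply: po_refl.
- move=> p q r; have [g [_ gP]] := witness (code p q + code q r + code p r).+1 nil.
  by rewrite -!gP; [apply: po_trans | lia | lia | lia].
- by move=> [x y] [x' y'] /(pcan_inj pickleK) [/cd_inj -> /cd_inj ->].
- by [].
exists (fun x y => phi (x, y)) => i; have [B BP] := supp i.
have [n nP] : exists n, forall p q, In p (list_prod B B) -> In q (list_prod B B) -> code p q < n.
  have bnd (s : list nat) : exists n, forall k, In k s -> k < n.
    elim: s => [|k s [n nP]]; first by exists 0.
    by exists (n + k.+1) => l [<-|/nP]; lia.
  have [n nP] := bnd (map (fun pq => code pq.1 pq.2) (list_prod (list_prod B B) (list_prod B B))).
  exists n => p q pB qB; apply: nP; apply/in_map_iff; exists (p, q); split=> //.
  exact: in_prod.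
have [g [gP ag]] := witness n [:: i].
apply: (BP g); last by apply: gP; left.
move=> x y x' y' xB yB xB' yB'; rewrite phiP -ag //.
by apply: nP; apply: in_prod.
Qed.

(** * Grids in the random partial order *)

Definition truth (A : Prop) : bool := excluded_middle_informative A.

Lemma truthP A : reflect A (truth A).
Proof. exact: sumboolP. Qed.

(* Coordinate [i] is a linear extension in which the elements above [u i] come last. *)
Lemma finite_realizer n (u : 'I_n -> P) : exists M (v : 'I_n -> 'I_n -> nat),
  [/\ forall k i, v k i < M,
      forall k l, u k = u l -> v k = v l,
      forall k l, lt (u k) (u l) -> forall i, v k i < v l i &
      forall k l, inc (u k) (u l) -> crossing (v k) (v l) /\ forall i, v k i <> v l i].
Proof.
pose down k := [set l | truth (le (u l) (u k))].
pose same k := fun l => truth (u l = u k).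
(* A linear extension: the size of the down-set comes first, and ties are broken by the first index
   with the same value. *)
pose r k := #|down k| * n + find (same k) (enum 'I_n).
have find_lt k : find (same k) (enum 'I_n) < n.
  rewrite -[X in _ < X](size_enum_ord n) -has_find; apply/hasP; exists k; first by rewrite mem_enum.
  by apply/truthP.
have r_lt k : r k < n * n + n.
  rewrite /r; apply: leq_trans (_ : #|down k| * n + n <= _); first by rewrite ltn_add2l.
  by rewrite leq_add2r leq_mul //; have := max_card (mem (down k)); rewrite card_ord.
have r_eq k l : u k = u l -> r k = r l by rewrite /r /down /same => ->.
have r_inj k l : r k = r l -> u k = u l.
  move=> e; have fe : find (same k) (enum 'I_n) = find (same l) (enum 'I_n).
    by have := congr1 (modn^~ n) e; rewrite !modnMDl !modn_small.
  have hs m : has (same m) (enum 'I_n) by rewrite has_find size_enum_ord.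
  have /truthP <- := nth_find k (hs k); have /truthP <- := nth_find k (hs l).
  by rewrite fe.
have r_mono k l : lt (u k) (u l) -> r k < r l.
  move=> kl; have : #|down k| < #|down l|.
    apply/proper_card/properP; split.
      apply/subsetP => m; rewrite !inE => /truthP mk; apply/truthP.
      by case: kl => kl _; apply: po_trans kl.
    exists l; rewrite !inE; first by apply/truthP/po_refl.
    by apply/truthP; apply: po_ltNge.
  move=> dkl; apply: leq_trans (_ : #|down k| * n + n <= _); first by rewrite ltn_add2l.
  by rewrite -mulSnr (leq_trans (leq_mul dkl (leqnn n))) ?leq_addr.
(* [B] exceeds every rank, so adding it puts the elements above [u i] after all others in coordinate
   [i]. *)
pose B := n * n + n.
exists (B.*2), (fun k i => truth (le (u i) (u k)) * B + r k); split.
- by move=> k i; have := r_lt k; rewrite -/B; case: truth; lia.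
- by move=> k l e; apply: functional_extensionality => i; rewrite e (r_eq k l).
- move=> k l kl i; have := r_mono _ _ kl.
  have : truth (le (u i) (u k)) <= truth (le (u i) (u l)).
    case: truthP => // ik; case: truthP => // -[]; by case: kl => kl _; apply: po_trans kl.
  by case: truth; case: truth => //=; rewrite -/B; lia.
move=> k l [nkl nlk].
have tk m : truth (le (u m) (u m)) = true by apply/truthP/po_refl.
have tkl : truth (le (u k) (u l)) = false by apply/truthP.
have tlk : truth (le (u l) (u k)) = false by apply/truthP.
have := r_lt k; have := r_lt l; rewrite -/B => rl rk.
split; first by split; [exists l | exists k]; rewrite tk ?tkl ?tlk; lia.
move=> i; have : r k <> r l by move=> /r_inj e; apply: nkl; rewrite e; apply: po_refl.
by case: truth; case: truth; lia.
Qed.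

(** The Boolean cube with its product order; a bit records a property inherited upwards, such as
    lying above a given point or failing to lie below one. *)
Definition leL (l l' : bool * bool * bool) : Prop :=
  [/\ l.1.1 -> l'.1.1, l.1.2 -> l'.1.2 & l.2 -> l'.2].

Local Notation bot := (false, false, false).

Lemma leL_refl l : leL l l.
Proof. by split. Qed.

Lemma leL_trans l m k : leL l m -> leL m k -> leL l k.
Proof. by move=> [a b c] [a' b' c']; split; auto. Qed.

Lemma leL_bot l : leL bot l.
Proof. by split. Qed.

(** The hypotheses make the disjoint union of the levelled grid and the points [kappa s] a preorder,
    which is embedded with [kappa] kept fixed. The last one prevents a [kappa s] from lying between
    two grid points, whatever their coordinates. *)
Lemma grid_embedding (K : finType) (kappa : K -> P) (A B : K -> bool * bool * bool -> Prop) d :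
  (forall s l l', leL l l' -> A s l -> A s l') ->
  (forall s l l', leL l l' -> B s l' -> B s l) ->
  (forall s s' l, le (kappa s) (kappa s') -> A s' l -> A s l) ->
  (forall s s' l, le (kappa s) (kappa s') -> B s l -> B s' l) ->
  (forall s s' l, A s l -> B s' l -> le (kappa s) (kappa s')) ->
  (forall s l l', B s l -> A s l' -> False) ->
  exists e : ('I_d -> nat) -> bool * bool * bool -> P,
  [/\ forall n n' l l', le (e n l) (e n' l') <-> (forall i, n i <= n' i) /\ leL l l',
      forall s n l, le (kappa s) (e n l) <-> A s l &
      forall s n l, le (e n l) (kappa s) <-> B s l].
Proof.
move=> Amono Bmono Ak Bk ABk BA.
pose X := ({ffun 'I_d -> nat} * (bool * bool * bool) + K)%type.
pose R (x y : X) := match x, y with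
  | inl p, inl q => (forall i, p.1 i <= q.1 i) /\ leL p.2 q.2
  | inl p, inr s => B s p.2
  | inr s, inl q => A s q.2
  | inr s, inr s' => le (kappa s) (kappa s')
  end.
have [_ _ _ _ ext] := HP.
have [||||p0 _] := ext nil (fun=> False) (fun=> False); try by [].
pose phi0 (x : X) := if x is inr s then kappa s else p0.
have [||||phi [phiK phiP]] := @embed_countable X R _ _ pickle (map inr (enum K)) phi0.
- by move=> [p|s] /=; [split=> //; apply: leL_refl | apply: po_refl].
- move=> [p|s] [q|s'] [r|s''] /=.
  + move=> [pq pq2] [qr qr2]; split; last exact: leL_trans qr2.
    by move=> i; apply: leq_trans (qr i).
  + by move=> [_ pq]; apply: Bmono.
  + by move=> pB /(BA _ _ _ pB).
  + by move=> pB ss; apply: Bk pB.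
  + by move=> sA [_ qr]; apply: Amono sA.
  + exact: ABk.
  + by move=> ss; apply: Ak.
  + exact: po_trans.
- exact: pcan_inj pickleK.
- by move=> x y /in_map_iff [s [<- _]] /in_map_iff [s' [<- _]].
have phik s : phi (inr s) = kappa s.
  by rewrite phiK //; apply/in_map; apply/In_memP; rewrite mem_enum.
exists (fun n l => phi (inl ([ffun i => n i], l))); split=> [n n' l l'|s n l|s n l].
- by rewrite phiP /=; split=> -[nn ll]; split=> // i; have := nn i; rewrite !ffunE.
- by rewrite -phik phiP.
- by rewrite -phik phiP.
Qed.

Lemma order_embedding_lt alpha x y : order_embedding le alpha -> lt (alpha x) (alpha y) <-> lt x y.
Proof.
move=> emb; rewrite /Defs.ltP emb; split=> -[xy nxy]; split=> // e; apply: nxy; first by rewrite e.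
by apply: po_anti; apply/emb; rewrite e; apply: po_refl.
Qed.

(** * Separating mixed pairs *)

Section Clone.

(** The binary polymorphisms, kept abstract: the hypotheses are closure and preservation properties
    that a reduct supplies. *)
Variable Pol : (P -> P -> P) -> Prop.
Hypothesis Pol_fst : Pol (fun x _ => x).
Hypothesis Pol_swap : forall g, Pol g -> Pol (fun x y => g y x).
Hypothesis Pol_comp : forall h g g', Pol h -> Pol g -> Pol g' -> Pol (fun x y => h (g x y) (g' x y)).
Hypothesis Pol_pre : forall g alpha beta, Pol g -> order_embedding le alpha ->
  order_embedding le beta -> Pol (fun x y => g (alpha x) (beta y)).
Hypothesis Pol_lt : forall g, Pol g -> forall x y x' y', lt x x' -> lt y y' -> lt (g x y) (g x' y').
Hypothesis Pol_inc : forall g, Pol g -> forall x y x' y', inc x x' -> inc y y' -> inc (g x y) (g x' y').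

(** If [g x' y'] were below [g x y], it would lie below [g z w] for [z] above [x] and [w] above [y]
    that are incomparable to [x'] and [y'], against preservation of incomparability. *)
Lemma Pol_lt_inc g x y x' y' : Pol g -> lt x x' -> inc y y' ->
  lt (g x y) (g x' y') \/ inc (g x y) (g x' y').
Proof.
move=> Pg xx yy; suff nle : ~ le (g x' y') (g x y).
  by case: (po_cases (g x y) (g x' y')) => [e|l|[l _]|i]; auto; case: nle; rewrite // e; apply: po_refl.
move=> l; have [z [xz zx]] := exists_above_inc (po_ltNge xx).
have [w [yw wy]] := exists_above_inc (proj2 yy).
have [_ []] := Pol_inc Pg zx wy.
by case: (po_le_lt_trans l (Pol_lt Pg xz yw)).
Qed.

Lemma Pol_inc_lt g x y x' y' : Pol g -> inc x x' -> lt y y' ->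
  lt (g x y) (g x' y') \/ inc (g x y) (g x' y').
Proof. by move=> Pg xx yy; apply: (@Pol_lt_inc (fun x y => g y x)) => //; apply: Pol_swap. Qed.

Definition grid_order_embedding d (e : ('I_d -> nat) -> bool * bool * bool -> P) : Prop :=
  forall n n' l l', le (e n l) (e n' l') <-> (forall i, n i <= n' i) /\ leL l l'.

(* The pairs of booleans record whether an element lies above the source and below the target
   of a distinguished pair, comparable for [LT] and incomparable for [INC]. *)
Definition breaks_low (f : P -> P -> P) : Prop :=
  exists LT INC : bool -> bool -> bool * bool * bool,
  [/\ forall p q p' q' : bool, (p -> p') -> (q' -> q) -> leL (LT p q) (LT p' q'),
      forall p q p' q' : bool, (p -> p') -> (q' -> q) -> leL (INC p q) (INC p' q') &
      forall d, exists e e' : ('I_d -> nat) -> bool * bool * bool -> P,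
      [/\ grid_order_embedding e, grid_order_embedding e',
          forall x y x' y', ~ lt (f (e x (LT true true)) (e' y (INC true false)))
                                 (f (e x' (LT true true)) (e' y' (INC false true))) &
          forall x y x' y', ~ lt (f (e x (INC true false)) (e' y (LT true true)))
                                 (f (e x' (INC false true)) (e' y' (LT true true)))]].

(** The failure of [Low] leaves two cases: [f a a'] is incomparable to both other values or below
    both. In each, suitable levels carry the violation over to whole grids. *)
Lemma fork_breaks_low f a b c a' b' c' : Pol f ->
  lt a b -> inc c a -> inc c b -> lt a' c' -> inc b' a' -> inc b' c' ->
  ~ Low le (f a a') (f b b') (f c c') -> breaks_low f.
Proof.
move=> Pf ab ca cb ac' ba' bc' nlow.
have vw := Pol_inc Pf cb (po_inc_sym bc').
have uv := Pol_lt_inc Pf ab (po_inc_sym ba').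
have uw := Pol_inc_lt Pf (po_inc_sym ca) ac'.
pose kap (a b c : P) (s : option bool) := if s is Some t then if t then b else c else a.
have kapP x y z s s' : lt x y -> inc z x -> inc z y -> le (kap x y z s) (kap x y z s') ->
    s = s' \/ (s = None /\ s' = Some true).
  move=> xy [zx xz] [zy yz]; case: s s' => [[]|] [[]|] //= l; try by auto; try by [].
  by case: (po_ltNge xy).
have [[uv1 uw1]|[uv1 uw1]] : (inc (f a a') (f b b') /\ inc (f a a') (f c c')) \/
    (lt (f a a') (f b b') /\ lt (f a a') (f c c')).
- case: uv => uv; case: uw => uw; auto; case: nlow; [left|right]; split=> //; split=> //;
  exact: po_inc_sym.
(* In the incomparable case, a [<] between the two grid values would complete a chain from [f a a']
   up to [f b b'] or [f c c']. *)
- exists (fun p q => (p, ~~ q, true)), (fun p q => (p, true, ~~ q)); split.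
  + by move=> p q p' q' pp qq; split=> //=; apply: contra.
  + by move=> p q p' q' pp qq; split=> //=; apply: contra.
  move=> d.
  pose A (s : option bool) (l : bool * bool * bool) : Prop := s = None /\ l.1.1.
  pose B (s : option bool) (l : bool * bool * bool) : Prop :=
    (s = Some true /\ ~~ l.1.2) \/ (s = Some false /\ ~~ l.1.1 /\ ~~ l.2).
  have E x y z : lt x y -> inc z x -> inc z y -> exists e : ('I_d -> nat) -> bool * bool * bool -> P,
      [/\ grid_order_embedding e,
          forall n (l : bool * bool * bool), l.1.1 -> lt x (e n l),
          forall n (l : bool * bool * bool), ~~ l.1.2 -> lt (e n l) y &
          forall n (l : bool * bool * bool), ~~ l.1.1 -> ~~ l.2 -> lt (e n l) z].
    move=> xy zx zy.
    have [||||||e [eP eA eB]] := @grid_embedding _ (kap x y z) A B d.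
    - by move=> s l l' [ll _ _] [-> la]; split; auto.
    - move=> s l l' [l1 l2 l3] [[-> lb]|[-> [lb lc]]]; [left | right]; split=> //.
        exact: contra lb.
      by split; [exact: contra lb | exact: contra lc].
    - by move=> s s' l /(kapP _ _ _ _ _ xy zx zy) [->|[-> ->]] //; case.
    - by move=> s s' l /(kapP _ _ _ _ _ xy zx zy) [->|[-> ->]] // [[]|[]].
    - by move=> s s' l [-> la] [[-> _]|[-> [nla _]]] /=; [case: xy | rewrite la in nla].
    - by move=> s l l' [[-> _]|[-> _]] [].
    exists e; split=> // n l.
    + move=> la; split; first by apply/(eA None).
      by move=> ex; have /(eB None) [[]|[]] : le (e n l) x by rewrite -ex; apply: po_refl.
    + move=> lb; split; first by apply/(eB (Some true)); left.
      by move=> ey; have /(eA (Some true)) [] : le y (e n l) by rewrite -ey; apply: po_refl.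
    + move=> la lc; split; first by apply/(eB (Some false)); right.
      by move=> ey; have /(eA (Some false)) [] : le z (e n l) by rewrite -ey; apply: po_refl.
  have [e [eP eA eB eC]] := E _ _ _ ab ca cb.
  have [e' [eP' eA' eB' eC']] := E _ _ _ ac' ba' bc'.
  exists e, e'; split=> // x y x' y' l.
  + case: uv1 => + _; apply.
    have l1 := Pol_lt Pf (eA x (true, false, true) isT) (eA' y (true, true, true) isT).
    have l2 := Pol_lt Pf (eB x' (true, false, true) isT) (eC' y' (false, true, false) isT isT).
    by case: (po_lt_trans l1 (po_lt_trans l l2)).
  case: uw1 => + _; apply.
  have l1 := Pol_lt Pf (eA x (true, true, true) isT) (eA' y (true, false, true) isT).
  have l2 := Pol_lt Pf (eC x' (false, true, false) isT isT) (eB' y' (true, false, true) isT).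
  by case: (po_lt_trans l1 (po_lt_trans l l2)).
(* As [f a a'] lies below [f b b'] and [f c c'], the value of a point incomparable to [(b, b')] or
   to [(c, c')] is not below the value of a point under [(a, a')]. *)
exists (fun p q => (~~ q, false, false)), (fun p q => (~~ q, false, false)); split.
- by move=> p q p' q' pp qq; split=> //=; apply: contra.
- by move=> p q p' q' pp qq; split=> //=; apply: contra.
move=> d.
pose B (s : option bool) (l : bool * bool * bool) : Prop := s <> Some false /\ ~~ l.1.1.
have E x y z : lt x y -> inc z x -> inc z y -> exists e : ('I_d -> nat) -> bool * bool * bool -> P,
    [/\ grid_order_embedding e,
        forall n (l : bool * bool * bool), ~~ l.1.1 -> lt (e n l) x,
        forall n (l : bool * bool * bool), l.1.1 -> inc (e n l) y &
        forall n l, inc (e n l) z].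
  move=> xy zx zy.
  have [||||||e [eP eA eB]] := @grid_embedding _ (kap x y z) (fun _ _ => False) B d; try by [].
  - by move=> s l l' [l1 l2 l3] [ns lb]; split=> //; apply: contra lb.
  - by move=> s s' l /(kapP _ _ _ _ _ xy zx zy) [->|[-> ->]] // [].
  exists e; split=> // n l.
  + move=> la; split; first by apply/(eB None).
    by move=> ex; have /(eA None) : le x (e n l) by rewrite -ex; apply: po_refl.
  + by move=> la; split=> [/(eB (Some true)) [_]|/(eA (Some true))] //; rewrite la.
  + by split=> [/(eB (Some false)) [] //|/(eA (Some false))].
have [e [eP eA eB eC]] := E _ _ _ ab ca cb.
have [e' [eP' eA' eB' eC']] := E _ _ _ ac' ba' bc'.
exists e, e'; split=> // x y x' y' /=  l.
- have l1 := Pol_lt Pf (eA x' bot isT) (eA' y' bot isT).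
  have [+ _] := Pol_inc Pf (eC x bot) (eB' y (true, false, false) isT); apply.
  by case: (po_lt_trans l (po_lt_trans l1 uw1)).
have l1 := Pol_lt Pf (eA x' bot isT) (eA' y' bot isT).
have [+ _] := Pol_inc Pf (eB x (true, false, false) isT) (eC' y bot); apply.
by case: (po_lt_trans l (po_lt_trans l1 uv1)).
Qed.

(** The coordinates alone decide the order of the tuple, so any monotone labelling by levels may be
    added. *)
Lemma grid_same_type n (u : 'I_n -> P) (v : 'I_n -> 'I_n -> nat) (theta : 'I_n -> nat -> nat)
    (e : ('I_n -> nat) -> bool * bool * bool -> P) (lam : 'I_n -> bool * bool * bool) :
  (forall i, increasing (theta i)) -> grid_order_embedding e ->
  (forall k l, u k = u l -> v k = v l) ->
  (forall k l, lt (u k) (u l) -> forall i, v k i < v l i) ->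
  (forall k l, inc (u k) (u l) -> crossing (v k) (v l)) ->
  (forall k l, le (u k) (u l) -> leL (lam k) (lam l)) ->
  same_type le u (fun k => e (fun i => theta i (v k i)) (lam k)).
Proof.
move=> inct eP veq vlt vinc lamP k l; rewrite eP; split=> [kl|[kl _]].
  split; last exact: lamP.
  case: (po_cases (u k) (u l)) => [/veq ->|/vlt h|/po_ltNge //|[]] // i.
  by apply: ltnW; apply: inct.
case: (po_cases (u k) (u l)) => [->|[]//|/vlt h|/vinc [_ [i h]]]; first exact: po_refl.
  by have := kl k; rewrite leqNgt inct.
by have := kl i; rewrite leqNgt inct.
Qed.

(** [u] and [w] are meant as the values of two operations on a finite list of points. Both tuples
    are moved onto grids on which [f] behaves as [grid_dichotomy] describes. *)
Lemma merge_step f n (u w : 'I_n -> P) i0 j0 : Pol f -> breaks_low f ->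
  lt (u i0) (u j0) -> inc (w i0) (w j0) ->
  exists h, [/\ Pol h,
    forall k l, inc (u k) (u l) -> lt (w k) (w l) -> ~ lt (h (u k) (w k)) (h (u l) (w l)) &
    ~ lt (h (u i0) (w i0)) (h (u j0) (w j0))].
Proof.
move=> Pf [LT [INC [LTm INCm brk]]] uij wij.
have [e [e' [eP eP' ebr ebr']]] := brk n.
have [Mu [vu [vuM vueq vult vuinc]]] := finite_realizer u.
have [Mw [vw [vwM vweq vwlt vwinc]]] := finite_realizer w.
pose F (x : bool -> 'I_n -> nat) (l : bool -> bool * bool * bool) :=
  f (e (x true) (l true)) (e' (x false) (l false)).
have grid_lt (E : ('I_n -> nat) -> bool * bool * bool -> P) x y l l' : grid_order_embedding E ->
    (forall i, x i < y i) -> leL l l' -> lt (E x l) (E y l').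
  move=> EP xy ll; split; first by apply/EP; split=> // i; apply: ltnW.
  move=> eq; have /EP [yx _] : le (E y l') (E x l) by rewrite eq; apply: po_refl.
  by have := yx i0; rewrite leqNgt xy.
have grid_inc (E : ('I_n -> nat) -> bool * bool * bool -> P) x y l l' : grid_order_embedding E ->
    crossing x y -> inc (E x l) (E y l').
  move=> EP [[i li] [j lj]]; split=> /EP [h _]; [have := h j | have := h i]; by rewrite leqNgt ?li ?lj.
have [|||theta [inct dich]] := @grid_dichotomy P lt n _ leL bot po_lt_trans _ F _ _ (Mu + Mw).
- exact: leL_bot.
- by move=> x y l l' xy ll; apply: Pol_lt => //; apply: grid_lt.
- move=> x y l l' xy ltF; have [+ _] : inc (F x l) (F y l') by apply: Pol_inc => //; apply: grid_inc.
  by apply; case: ltF.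
pose lev (LI : bool -> bool -> bool * bool * bool) (s : 'I_n -> P) k :=
  LI (truth (le (s i0) (s k))) (truth (le (s k) (s j0))).
have levP LI s : (forall p q p' q' : bool, (p -> p') -> (q' -> q) -> leL (LI p q) (LI p' q')) ->
    forall k l, le (s k) (s l) -> leL (lev LI s k) (lev LI s l).
  move=> LIm k l kl; apply: LIm => /truthP h; apply/truthP; first exact: po_trans kl.
  exact: po_trans h.
have tr s k : truth (le (s k) (s k)) = true by apply/truthP/po_refl.
have levLT : lev LT u i0 = LT true true /\ lev LT u j0 = LT true true.
  by rewrite /lev !tr; have -> : truth (le (u i0) (u j0)) = true by apply/truthP; case: uij.
have levINC : lev INC w i0 = INC true false /\ lev INC w j0 = INC false true.
  by rewrite /lev !tr; have -> : truth (le (w i0) (w j0)) = false by apply/truthP; case: wij.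
have [{levLT}ltE ltE'] := levLT; have [{levINC}incE incE'] := levINC.
have sameu lam (E : ('I_n -> nat) -> bool * bool * bool -> P) b : grid_order_embedding E ->
    (forall k l, le (u k) (u l) -> leL (lam k) (lam l)) ->
    same_type le u (fun k => E (fun i => theta b i (vu k i)) (lam k)).
  by move=> EP lamP; apply: (grid_same_type (theta := theta b)) => // k l /vuinc [].
have samew lam (E : ('I_n -> nat) -> bool * bool * bool -> P) b : grid_order_embedding E ->
    (forall k l, le (w k) (w l) -> leL (lam k) (lam l)) ->
    same_type le w (fun k => E (fun i => theta b i (vw k i)) (lam k)).
  by move=> EP lamP; apply: (grid_same_type (theta := theta b)) => // k l /vwinc [].
have bu x : bounded (Mu + Mw) (fun c i => if c then vu x i else vw x i).
  by case=> i; [apply: ltn_addr | apply: ltn_addl].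
have bw x : bounded (Mu + Mw) (fun c i => if c then vw x i else vu x i).
  by case=> i; [apply: ltn_addl | apply: ltn_addr].
case: dich => [[l lP]|[[|] lP]].
(* At the levels [l] every mixed pair is settled, so all points of an argument share one level. *)
- have [al [alP alE]] := order_embedding_extend (sameu (fun=> l true) e true eP (fun _ _ _ => leL_refl _)).
  have [be [beP beE]] := order_embedding_extend (samew (fun=> l false) e' false eP' (fun _ _ _ => leL_refl _)).
  exists (fun x y => f (al x) (be y)); split; first exact: Pol_pre.
    move=> k m ukm wkm; rewrite !alE !beE; have [cr ne] := vuinc _ _ ukm.
    exact: (lP false _ _ (bu k) (bu m) (vwlt _ _ wkm) cr ne).
  rewrite !alE !beE; have [cr ne] := vwinc _ _ wij.
  exact: (lP true _ _ (bu i0) (bu j0) (vult _ _ uij) cr ne).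
(* Pairs that cross in the first argument are settled; the chosen pair is settled by the levels from
   [breaks_low]. *)
- have [al [alP alE]] := order_embedding_extend (sameu _ e true eP (levP _ u LTm)).
  have [be [beP beE]] := order_embedding_extend (samew _ e' false eP' (levP _ w INCm)).
  exists (fun x y => f (al x) (be y)); split; first exact: Pol_pre.
    move=> k m ukm wkm; rewrite !alE !beE; have [cr _] := vuinc _ _ ukm.
    exact: (lP (fun c => if c then lev LT u k else lev INC w k)
      (fun c => if c then lev LT u m else lev INC w m) _ _ (bu k) (bu m) cr (vwlt _ _ wkm)).
  by rewrite !alE !beE ltE ltE' incE incE'; apply: ebr.
have [al [alP alE]] := order_embedding_extend (samew _ e true eP (levP _ w INCm)).
have [be [beP beE]] := order_embedding_extend (sameu _ e' false eP' (levP _ u LTm)).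
exists (fun x y => f (al y) (be x)); split.
- by apply: (Pol_swap (g := fun x y => f (al x) (be y))); apply: Pol_pre.
- move=> k m ukm wkm; rewrite !alE !beE; have [cr _] := vuinc _ _ ukm.
  exact: (lP (fun c => if c then lev INC w k else lev LT u k)
    (fun c => if c then lev INC w m else lev LT u m) _ _ (bw k) (bw m) cr (vwlt _ _ wkm)).
by rewrite !alE !beE ltE ltE' incE incE'; apply: ebr'.
Qed.

Definition mixed (p q : P * P) : Prop :=
  (lt p.1 q.1 /\ inc p.2 q.2) \/ (inc p.1 q.1 /\ lt p.2 q.2).

Local Notation app g p := (g p.1 p.2).

Lemma Pol_mixed g p q : Pol g -> mixed p q -> lt (app g p) (app g q) \/ inc (app g p) (app g q).
Proof. by move=> Pg [[]|[]]; [apply: Pol_lt_inc | apply: Pol_inc_lt]. Qed.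

Lemma In_nth_ord (T : Type) (x0 x : T) (s : seq T) : In x s -> exists i : 'I_(size s), nth x0 s i = x.
Proof.
elim: s => //= y s IH [->|/IH [i <-]]; first by exists ord0.
by exists (lift ord0 i).
Qed.

Lemma break_mixed_pair f p q : Pol f -> breaks_low f -> mixed p q ->
  exists g, Pol g /\ ~ lt (app g p) (app g q).
Proof.
move=> Pf brk; pose sel (x y : P) (k : 'I_2) := if val k == 0 then x else y.
move=> [[l i]|[i l]].
  by have [h [Ph _ hP]] := @merge_step f 2 (sel p.1 q.1) (sel p.2 q.2) o0_2 o1_2 Pf brk l i; exists h.
have [h [Ph _ hP]] := @merge_step f 2 (sel p.2 q.2) (sel p.1 q.1) o0_2 o1_2 Pf brk l i.
by exists (fun x y => h y x); split=> //; apply: Pol_swap.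
Qed.

Lemma break_mixed_list f (K : list ((P * P) * (P * P))) : Pol f -> breaks_low f ->
  (forall e, In e K -> mixed e.1 e.2) ->
  exists g, Pol g /\ forall e, In e K -> ~ lt (app g e.1) (app g e.2).
Proof.
move=> Pf brk; elim: K => [|e K IH] mK; first by exists (fun x _ => x).
have [|g [Pg gP]] := IH; first by move=> e' Ke'; apply: mK; right.
have me : mixed e.1 e.2 by apply: mK; left.
case: (classic (lt (app g e.1) (app g e.2))) => [lte|nlte]; last first.
  by exists g; split=> // e' [<-|/gP].
have [g' [Pg' g'P]] := break_mixed_pair Pf brk me.
have ince : inc (app g' e.1) (app g' e.2) by case: (Pol_mixed Pg' me).
pose s := List.app (List.map fst (e :: K)) (List.map snd (e :: K)).
have s1 e' : In e' (e :: K) -> In e'.1 s.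
  by move=> Ke; apply/in_or_app; left; apply: in_map.
have s2 e' : In e' (e :: K) -> In e'.2 s.
  by move=> Ke; apply/in_or_app; right; apply: in_map.
have ix p : In p s -> exists i : 'I_(size s), nth e.1 s i = p by apply: In_nth_ord.
have [i0 ei] := ix _ (s1 e (or_introl erefl)); have [j0 ej] := ix _ (s2 e (or_introl erefl)).
have [|| h [Ph h1 h2]] := @merge_step f _ (fun i => app g (nth e.1 s i))
  (fun i => app g' (nth e.1 s i)) i0 j0 Pf brk; rewrite ?ei ?ej //.
exists (fun x y => h (g x y) (g' x y)); split; first exact: Pol_comp.
move=> e' [<-|Ke']; first by move: h2; rewrite ei ej.
have me' : mixed e'.1 e'.2 by apply: mK; right.
have ge' : inc (app g e'.1) (app g e'.2) by case: (Pol_mixed Pg me') => // /(gP _ Ke').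
have [k ek] := ix _ (s1 e' (or_intror Ke')); have [l el] := ix _ (s2 e' (or_intror Ke')).
case: (Pol_mixed Pg' me') => g'e'; first by have := h1 k l; rewrite ek el; apply.
by have [+ _] := Pol_inc Ph ge' g'e' => nle [].
Qed.

Definition same_on (B : list P) (g g' : P -> P -> P) : Prop :=
  forall x y x' y', In x B -> In y B -> In x' B -> In y' B ->
    (le (g x y) (g x' y') <-> le (g' x y) (g' x' y')).

Hypothesis Pol_local : forall g, (forall B, exists g', Pol g' /\ same_on B g' g) -> Pol g.

Definition splits (g : P -> P -> P) : Prop := forall p q, mixed p q -> inc (app g p) (app g q).

Lemma exists_splits f : Pol f -> breaks_low f -> exists g, Pol g /\ splits g.
Proof.
move=> Pf brk.
pose C (B : list P) (g : P -> P -> P) := exists g', [/\ Pol g', same_on B g' g &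
  forall x y x' y', In x B -> In y B -> In x' B -> In y' B ->
    mixed (x, y) (x', y') -> ~ lt (g' x y) (g' x' y')].
have [||g gP] := @binary_compactness _ C.
- move=> B; exists B => g g' gg' [h [Ph hg hP]]; exists h; split=> // x y x' y' xB yB xB' yB'.
  by rewrite hg //; apply: gg'.
- move=> K; pose B := concat K.
  pose E := List.filter (fun e => truth (mixed e.1 e.2))
    (list_prod (list_prod B B) (list_prod B B)).
  have [|g [Pg gP]] := @break_mixed_list f E Pf brk.
    by move=> e /filter_In [_ /truthP].
  exists g => B0 KB0; exists g; split=> // x y x' y' xB yB xB' yB' m.
  have inB z : In z B0 -> In z B by move=> zB; apply/in_concat; exists B0.
  apply: (gP ((x, y), (x', y'))); apply/filter_In; split; last by apply/truthP.
  by do !apply: in_prod; apply: inB.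
have Pg : Pol g by apply: Pol_local => B; have [g' [Pg' g'g _]] := gP B; exists g'.
exists g; split=> // -[x y] [x' y'] m; case: (Pol_mixed Pg m) => //= ltg.
have [g' [Pg' g'g g'P]] := gP [:: x; y; x'; y'].
case: (g'P x y x' y' _ _ _ _ m); rewrite /=; auto.
have gg := g'g; split; first by apply/gg; rewrite /=; auto; case: ltg.
move=> e; apply: (po_ltNge ltg); apply/gg; rewrite /=; auto.
by rewrite e; apply: po_refl.
Qed.

Lemma splits_swap g : splits g -> splits (fun x y => g y x).
Proof.
by move=> sg p q [m|m]; apply: (sg (p.2, p.1) (q.2, q.1)); [right | left] => /=; tauto.
Qed.

Lemma splits_pre g alpha beta : order_embedding le alpha -> order_embedding le beta ->
  splits g -> splits (fun x y => g (alpha x) (beta y)).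
Proof.
move=> aP bP sg p q m; apply: (sg (alpha p.1, beta p.2) (alpha q.1, beta q.2)).
by case: m => -[m1 m2]; [left | right]; rewrite /= order_embedding_lt // /incompP ?aP ?bP.
Qed.

Lemma splits_comp h g g' : Pol h -> Pol g' -> splits h -> splits g ->
  splits (fun x y => h (g x y) (g' x y)).
Proof.
move=> Ph Pg' sh sg p q m; case: (Pol_mixed Pg' m) => g'pq; last by apply: Pol_inc => //; apply: sg.
by apply: (sh (app g p, app g' p) (app g q, app g' q)); right; split=> //; apply: sg.
Qed.

Lemma splits_not_le g p q : Pol g -> splits g -> le p.1 q.1 -> ~ le p.2 q.2 ->
  ~ le (app g p) (app g q).
Proof.
move=> Pg sg le1 nle2 lepq; have [z [zp zq]] := exists_below_inc nle2.
have [w wp] := exists_below p.1.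
have [+ _] : inc (g w z) (app g q) by apply: (sg (w, z) q); left; split=> //; apply: po_lt_le_trans le1.
by apply; have [] := po_lt_le_trans (Pol_lt Pg wp zp) lepq.
Qed.

Lemma splits_le g p q : Pol g -> splits g -> le (app g p) (app g q) -> le p.1 q.1 /\ le p.2 q.2.
Proof.
move=> Pg sg lepq.
case: (classic (le p.1 q.1)) => [l1|n1]; case: (classic (le p.2 q.2)) => [l2|n2] //.
- by case: (splits_not_le Pg sg l1 n2).
- by case: (splits_not_le (p := (p.2, p.1)) (q := (q.2, q.1)) (Pol_swap Pg) (splits_swap sg) l2 n1).
have gt (x y : P) : ~ le x y -> lt y x \/ inc y x.
  move=> n; case: (po_cases x y) => [e|[]|?|/po_inc_sym ?] //; auto.
  by case: n; rewrite e; apply: po_refl.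
case: (gt _ _ n1) => r1; case: (gt _ _ n2) => r2.
- by case: (po_ltNge (Pol_lt Pg r1 r2)).
- by have [_ []] : inc (app g q) (app g p) by apply: sg; left.
- by have [_ []] : inc (app g q) (app g p) by apply: sg; right.
by have [_ []] := Pol_inc Pg r1 r2.
Qed.

Definition half_equal (p q : P * P) : Prop :=
  (p.1 = q.1 /\ lt p.2 q.2) \/ (lt p.1 q.1 /\ p.2 = q.2).

Lemma splits_half_equal g p q : Pol g -> splits g -> half_equal p q ->
  lt (app g p) (app g q) \/ inc (app g p) (app g q).
Proof.
move=> Pg sg hpq; have nqp : ~ le (app g q) (app g p).
  by case/(splits_le Pg sg) => l1 l2; case: hpq => -[]; [move=> _ /po_ltNge | move=> /po_ltNge].
case: (po_cases (app g p) (app g q)) => [e|l|[l _]|i]; auto; case: nqp => //.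
by rewrite e; apply: po_refl.
Qed.

Lemma half_equal_transfer g0 p q : Pol g0 -> splits g0 -> half_equal p q ->
  ~ lt (app g0 p) (app g0 q) -> forall p' q', half_equal p' q' ->
  exists g, [/\ Pol g, splits g & inc (app g p') (app g q')].
Proof.
move=> Pg0 sg0 hpq npq.
have [g1 [x [y [y' [Pg1 sg1 yy ixy]]]]] : exists g1 x y y',
    [/\ Pol g1, splits g1, lt y y' & inc (g1 x y) (g1 x y')].
  have ipq : inc (app g0 p) (app g0 q) by case: (splits_half_equal Pg0 sg0 hpq).
  case: p q hpq ipq {npq} => [x y] [x' y'] [] [/= e l] i.
    by exists g0, x, y, y'; rewrite -e in i.
  exists (fun x y => g0 y x), y, x, x'; rewrite -l in i.
  by split=> //; [apply: Pol_swap | apply: splits_swap].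
have tr z w w' : lt w w' -> exists g, [/\ Pol g, splits g & inc (g z w) (g z w')].
  move=> ww.
  have [|al [alP alE]] := @order_embedding_extend 1 (fun=> z) (fun=> x).
    by move=> i j; split=> _; apply: po_refl.
  pose sel (x y : P) (k : 'I_2) := if val k == 0 then x else y.
  have [|be [beP beE]] := @order_embedding_extend 2 (sel w w') (sel y y').
    have r u : le u u <-> True by split=> // _; apply: po_refl.
    have l u v : lt u v -> (le u v <-> True) /\ (le v u <-> False).
      by move=> uv; split; split=> //; [case: uv | apply: po_ltNge].
    have [l1 l2] := l _ _ ww; have [l3 l4] := l _ _ yy.
    by case=> [[|[|i]] i2] [[|[|j]] j2] //; rewrite /sel /= ?r ?l1 ?l2 ?l3 ?l4.
  exists (fun x y => g1 (al x) (be y)); split; first exact: Pol_pre.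
    exact: splits_pre.
  by rewrite (alE ord0) (beE o0_2 : be w = y) (beE o1_2 : be w' = y').
move=> [z w] [z' w'] [] [/= e l].
  by rewrite -e; apply: tr.
have [g [Pg sg ig]] := tr w _ _ e; exists (fun x y => g y x); rewrite -l.
by split=> //; [apply: Pol_swap | apply: splits_swap].
Qed.

Lemma break_half_equal_list g0 p q (K : list ((P * P) * (P * P))) : Pol g0 -> splits g0 ->
  half_equal p q -> ~ lt (app g0 p) (app g0 q) ->
  (forall e, In e K -> half_equal e.1 e.2) ->
  exists g, [/\ Pol g, splits g & forall e, In e K -> inc (app g e.1) (app g e.2)].
Proof.
move=> Pg0 sg0 hpq npq; elim: K => [|e K IH] hK; first by exists g0.
have [|g [Pg sg gP]] := IH; first by move=> e' Ke'; apply: hK; right.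
have [g' [Pg' sg' g'e]] := half_equal_transfer Pg0 sg0 hpq npq (hK e (or_introl erefl)).
exists (fun x y => g0 (g x y) (g' x y)); split; first exact: Pol_comp.
  exact: splits_comp.
move=> e' Ke'; have he' := hK _ Ke'.
have h1 := splits_half_equal Pg sg he'; have h2 := splits_half_equal Pg' sg' he'.
have m : inc (app g e'.1) (app g e'.2) \/ inc (app g' e'.1) (app g' e'.2).
  by case: Ke' => [<-|/gP]; auto.
pose a := (app g e'.1, app g' e'.1); pose b := (app g e'.2, app g' e'.2).
case: h1 => h1; case: h2 => h2.
- by case: m => -[]; case: h1; case: h2.
- by apply: (sg0 a b); left.
- by apply: (sg0 a b); right.
exact: Pol_inc.
Qed.

Lemma Pol_embedding f e_lt e_le : Pol f -> breaks_low f ->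
  embedding_lt2 le e_lt -> embedding_le2 le e_le -> Pol e_lt \/ Pol e_le.
Proof.
move=> Pf brk [lt_inj ltE] [le_inj leE]; have [g0 [Pg0 sg0]] := exists_splits Pf brk.
case: (classic (forall g p q, Pol g -> splits g -> half_equal p q -> lt (app g p) (app g q))) => [H|H].
  right; apply: Pol_local => B; exists g0; split=> // x y x' y' _ _ _ _; rewrite leE.
  split=> [/(splits_le (p := (x, y)) (q := (x', y')) Pg0 sg0) //|[l1 l2]].
  have hlt p q : half_equal p q -> le (app g0 p) (app g0 q) by move=> h; case: (H _ _ _ Pg0 sg0 h).
  case: (classic (x = x')) => [<-|nx]; case: (classic (y = y')) => [<-|ny].
  - exact: po_refl.
  - by apply: (hlt (x, y) (x, y')); left.
  - by apply: (hlt (x, y) (x', y)); right.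
  by case: (Pol_lt Pg0 (conj l1 nx) (conj l2 ny)).
have {H} [g [p [q [Pg sg hpq npq]]]] :
    exists g p q, [/\ Pol g, splits g, half_equal p q & ~ lt (app g p) (app g q)].
  apply: NNPP => nH; apply: H => g p q Pg sg h; apply: NNPP => npq.
  by apply: nH; exists g, p, q.
left; apply: Pol_local => B.
pose E := List.filter (fun e => truth (half_equal e.1 e.2))
  (list_prod (list_prod B B) (list_prod B B)).
have [|h [Ph sh hP]] := @break_half_equal_list g p q E Pg sg hpq npq.
  by move=> e /filter_In [_ /truthP].
exists h; split=> // x y x' y' xB yB xB' yB'.
have hB : half_equal (x, y) (x', y') -> ~ le (h x y) (h x' y').
  move=> hh; have [] // : inc (h x y) (h x' y').
  apply: (hP ((x, y), (x', y'))); apply/filter_In; split; last by apply/truthP.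
  by do !apply: in_prod.
split=> [lh|l].
  have [/= l1 l2] := splits_le (p := (x, y)) (q := (x', y')) Ph sh lh.
  case: (classic (x = x')) => [ex|nx]; case: (classic (y = y')) => [ey|ny].
  - by rewrite ex ey; apply: po_refl.
  - by case: hB => //; left.
  - by case: hB => //; right.
  by have [] : lt (e_lt x y) (e_lt x' y') by apply/ltE.
case: (classic (e_lt x y = e_lt x' y')) => [/lt_inj [-> ->]|ne]; first exact: po_refl.
by have /ltE [lx ly] : lt (e_lt x y) (e_lt x' y') by []; case: (Pol_lt Ph lx ly).
Qed.

End Clone.

(** * Polymorphisms of reducts *)

Definition triple (x y z : P) (k : 'I_3) : P :=
  if val k == 0 then x else if val k == 1 then y else z.

Lemma forall_ord3 (Q : 'I_3 -> Prop) : Q o0_3 -> Q o1_3 -> Q o2_3 -> forall i, Q i.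
Proof.
move=> Q0 Q1 Q2 [[|[|[|i]]] lti] //.
- by rewrite (_ : Ordinal lti = o0_3) //; apply: val_inj.
- by rewrite (_ : Ordinal lti = o1_3) //; apply: val_inj.
- by rewrite (_ : Ordinal lti = o2_3) //; apply: val_inj.
Qed.

Lemma po_ltE x y : lt x y <-> le x y /\ ~ le y x.
Proof.
split=> [l|[l n]]; first by split; [case: l | apply: po_ltNge].
by split=> // e; apply: n; rewrite e; apply: po_refl.
Qed.

Lemma Low_same_type t t' : same_type le t t' -> LowRel le t -> LowRel le t'.
Proof. by move=> tt'; rewrite /LowRel /Low /incompP !po_ltE !tt'. Qed.

Lemma fork_same_type a b c x y z : lt a b -> inc c a -> inc c b -> lt x y -> inc z x -> inc z y ->
  same_type le (triple a b c) (triple x y z).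
Proof.
move=> /po_ltE [? ?] [? ?] [? ?] /po_ltE [? ?] [? ?] [? ?].
have r u : le u u by apply: po_refl.
have := r a; have := r b; have := r c; have := r x; have := r y; have := r z.
by move=> ? ? ? ? ? ?; apply: forall_ord3; apply: forall_ord3; rewrite /triple /=; tauto.
Qed.

Lemma pp_definable_Pol (G : structure P) n (R : ('I_n -> P) -> Prop) f t t' :
  pp_definable G R -> in_Pol2 G f -> R t -> R t' -> R (fun i => f (t i) (t' i)).
Proof.
move=> [atoms atP] Pf /atP [e [et ea]] /atP [e' [et' ea']]; apply/atP.
exists (fun k => f (e k) (e' k)); split=> [i|at_ in_at]; first by rewrite et et'.
by case: at_ in_at (ea _ in_at) (ea' _ in_at) => [i j|s v] _ /=; [move=> -> -> | apply: Pf].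
Qed.

Section Reduct.

Variable G : structure P.
Hypothesis HG : reduct le G.

Lemma rel_same_type s t t' : same_type le t t' -> @Defs.rel P G s t -> @Defs.rel P G s t'.
Proof. exact: fo_definable_same_type. Qed.

Lemma in_enum_values n (t : 'I_n -> P) i : In (t i) (List.map t (enum 'I_n)).
Proof. by apply: in_map; apply/In_memP; rewrite mem_enum. Qed.

(* Otherwise finitely many constraints of preservation already force the triple of values into
   [Low]; read as a primitive positive formula with one variable for each point of [P * P] they
   define [Low], because both orbits of [Low] arise by projection. *)
Lemma exists_Pol_not_Low a b c a' b' c' : ~ pp_definable G (LowRel le) ->
  lt a b -> inc c a -> inc c b -> lt a' c' -> inc b' a' -> inc b' c' ->
  exists f, in_Pol2 G f /\ ~ Low le (f a a') (f b b') (f c c').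
Proof.
move=> npp ab ca cb ac' ba' bc'; apply: NNPP => nex; apply: npp.
pose cstr := {s : idx G & {r : ('I_(ar s) -> P) * ('I_(ar s) -> P) | Defs.rel r.1 /\ Defs.rel r.2}}.
pose left_ (x : cstr) := (proj1_sig (projT2 x)).1.
pose right_ (x : cstr) := (proj1_sig (projT2 x)).2.
pose holds (x : cstr) (g : P -> P -> P) := Defs.rel (fun j => g (left_ x j) (right_ x j)).
pose C (i : option cstr) g :=
  if i is Some x then holds x g else ~ Low le (g a a') (g b b') (g c c').
have supp i : exists B : list P, forall g g',
    (forall x y x' y', In x B -> In y B -> In x' B -> In y' B ->
      (le (g x y) (g x' y') <-> le (g' x y) (g' x' y'))) -> C i g -> C i g'.
  case: i => [x|].
    exists (List.app (List.map (left_ x) (enum 'I_(ar (projT1 x))))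
                (List.map (right_ x) (enum 'I_(ar (projT1 x))))) => g g' gg'.
    apply: rel_same_type => i j.
    by apply: gg'; apply/in_or_app; [left | right | left | right]; apply: in_enum_values.
  exists [:: a; b; c; a'; b'; c'] => g g' gg' /= nl l; apply: nl.
  apply: (@Low_same_type (triple (g' a a') (g' b b') (g' c c')) (triple (g a a') (g b b') (g c c'))) => //.
  by apply: forall_ord3; apply: forall_ord3; rewrite /triple /=; symmetry; apply: gg'; rewrite /=; tauto.
have [K KP] : exists K : list (option cstr), forall g, ~ (forall i, In i K -> C i g).
  apply: NNPP => nK; apply: nex.
  have [|f fP] := binary_compactness supp.
    move=> K; apply: NNPP => nKg; apply: nK; exists K => g gP; apply: nKg; by exists g.
  exists f; split; last exact: (fP None).
  move=> s t t' Rt Rt'; exact: (fP (Some (existT _ s (exist _ (t, t') (conj Rt Rt'))))).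
have [_ _ _ [cd cd_inj] _] := HP.
pose var p := if truth (p = (a, a')) then 0 else if truth (p = (b, b')) then 1 else
  if truth (p = (c, c')) then 2 else (pickle (cd p.1, cd p.2)).+3.
have var_inj : injective var.
  move=> p q; rewrite /var; do 6?case: truthP => ?; try congruence.
  by move=> [/(pcan_inj pickleK) [/cd_inj e1 /cd_inj e2]]; rewrite [p]surjective_pairing e1 e2 -surjective_pairing.
have va : var (a, a') = 0 by rewrite /var; case: truthP.
have vb : var (b, b') = 1.
  rewrite /var; case: truthP => [[e _]|_]; first by case: ab => _ /(_ (esym e)).
  by case: truthP.
have vc : var (c, c') = 2.
  rewrite /var; case: truthP => [[e _]|_]; first by case: ca => -[]; rewrite e; apply: po_refl.
  case: truthP => [[e _]|_]; first by case: cb => -[]; rewrite e; apply: po_refl.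
  by case: truthP.
have [dec decK] : exists dec : nat -> P * P, forall p, dec (var p) = p.
  have [|dec decP] := choice (fun n p => forall q, var q = n -> p = q).
    move=> n; case: (classic (exists q, var q = n)) => [[q <-]|H]; last first.
      by exists (a, a') => q qn; case: H; exists q.
    by exists q => q' /var_inj.
  by exists dec => p; apply: decP.
have da : dec 0 = (a, a') by rewrite -va.
have db : dec 1 = (b, b') by rewrite -vb.
have dc : dec 2 = (c, c') by rewrite -vc.
have [atoms atP] : exists atoms : list (atom G), forall e : nat -> P,
    (forall at_, In at_ atoms -> atom_sat e at_) <->
    (forall x, In (Some x) K -> holds x (fun y z => e (var (y, z)))).
  elim: {KP} K => [|[x|] K [atoms atP]]; first by exists nil.
    exists (@ARel P G (projT1 x) (fun j => var (left_ x j, right_ x j)) :: atoms) => e.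
    split=> [h y [[<-]|yK]|h at_ [<-|at_in]].
    - by apply: (h (ARel _)); left.
    - by apply: (proj1 (atP e)) yK => at_ at_in; apply: h; right.
    - by apply: (h x); left.
    by apply: (proj2 (atP e)) at_in => y yK; apply: h; right.
  exists atoms => e; rewrite atP; split=> h y; first by case=> // yK; apply: h.
  by move=> yK; apply: h; right.
exists atoms => t; split=> [lt_|[e [et /atP ea]]]; last first.
  apply: NNPP => nl; apply: (KP (fun y z => e (var (y, z)))) => -[x|] xK; first exact: ea.
  by rewrite /= va vb vc => l; apply: nl; rewrite /LowRel -!et.
case: lt_ => [[l [i1 i2]]|[l [i1 i2]]].
  have [al [alP alE]] := order_embedding_extend (fork_same_type ab ca cb l i1 i2).
  exists (fun k => al (dec k).1); split.
    apply: forall_ord3.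
    - by rewrite [dec _]da; apply: (alE o0_3).
    - by rewrite [dec _]db; apply: (alE o1_3).
    by rewrite [dec _]dc; apply: (alE o2_3).
  apply/atP => x _; apply: (@rel_same_type _ (left_ x)); last by case: (proj2_sig (projT2 x)).
  by move=> i j; rewrite !decK; split=> /alP.
have [al [alP alE]] := order_embedding_extend (fork_same_type ac' ba' bc' l i1 i2).
exists (fun k => al (dec k).2); split.
  apply: forall_ord3.
  - by rewrite [dec _]da; apply: (alE o0_3).
  - by rewrite [dec _]db; apply: (alE o2_3).
  by rewrite [dec _]dc; apply: (alE o1_3).
apply/atP => x _; apply: (@rel_same_type _ (right_ x)); last by case: (proj2_sig (projT2 x)).
by move=> i j; rewrite !decK; split=> /alP.
Qed.

Lemma in_Pol2_local g :
  (forall B, exists g', in_Pol2 G g' /\ same_on B g' g) -> in_Pol2 G g.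
Proof.
move=> gP s t t' Rt Rt'.
have [g' [Pg' g'g]] := gP (List.app (List.map t (enum 'I_(ar s))) (List.map t' (enum 'I_(ar s)))).
apply: rel_same_type (Pg' s t t' Rt Rt') => i j.
by apply: g'g; apply/in_or_app; [left | right | left | right]; apply: in_enum_values.
Qed.

End Reduct.

End RandomPoset.

Theorem theorem46 (P : Type) (le : P -> P -> Prop) (HP : random_po le)
  (G : structure P) (HG : reduct le G)
  (e_lt e_le : P -> P -> P)
  (He_lt : embedding_lt2 le e_lt) (He_le : embedding_le2 le e_le)
  (Hbot : pp_definable G (IncompRel le))
  (Hlt : pp_definable G (LtRel le)) :
  ~ pp_definable G (LowRel le) <-> (in_Pol2 G e_lt \/ in_Pol2 G e_le).
Proof.
have [a [b [c [ab ca cb]]]] := exists_fork HP.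
split=> [npp|].
  have [f [Pf nlow]] := exists_Pol_not_Low HP HG npp ab ca cb ab ca cb.
  have Pswap g : in_Pol2 G g -> in_Pol2 G (fun x y => g y x) by move=> Pg s t t' Rt Rt'; apply: Pg.
  have Ppre g al be : in_Pol2 G g -> order_embedding le al -> order_embedding le be ->
      in_Pol2 G (fun x y => g (al x) (be y)).
    move=> Pg alP beP s t t' Rt Rt'.
    apply: (Pg s (fun j => al (t j)) (fun j => be (t' j))).
      by apply: (rel_same_type HP HG) Rt => i j; symmetry; apply: alP.
    by apply: (rel_same_type HP HG) Rt' => i j; symmetry; apply: beP.
  pose pair (x y : P) (k : 'I_2) := if val k == 0 then x else y.
  have Plt g : in_Pol2 G g -> forall x y x' y', Defs.ltP le x x' -> Defs.ltP le y y' ->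
      Defs.ltP le (g x y) (g x' y').
    by move=> Pg x y x' y'; apply: (pp_definable_Pol Hlt Pg (t := pair x x') (t' := pair y y')).
  have Pinc g : in_Pol2 G g -> forall x y x' y', incompP le x x' -> incompP le y y' ->
      incompP le (g x y) (g x' y').
    by move=> Pg x y x' y'; apply: (pp_definable_Pol Hbot Pg (t := pair x x') (t' := pair y y')).
  apply: (Pol_embedding HP (Pol := in_Pol2 G) _ Pswap _ Ppre Plt Pinc _ Pf _ He_lt He_le).
  - by move=> s t t' Rt.
  - by move=> h g g' Ph Pg Pg' s t t' Rt Rt'; apply: Ph; [apply: Pg | apply: Pg'].
  - exact: (in_Pol2_local HP HG).
  - by apply: (fork_breaks_low HP Pswap Plt Pinc Pf ab ca cb ab ca cb nlow).
move=> Pe pp.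
have low1 : LowRel le (triple a b c) by left.
have low2 : LowRel le (triple a c b) by right.
have [nba nab] := ca; have [nbc ncb] := cb.
case: Pe => Pe; have := pp_definable_Pol pp Pe low1 low2.
  by case=> -[/(proj2 He_lt) [[] l1 _ [] l2 _]].
by case=> -[[/(proj2 He_le) []]].
Qed.
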